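(* There is an absolute constant $c$ such that the following holds for all integers $d\ge2$ and $n,r\ge1$. Let $G_n$ be a random $2d$-regular graph on $n$ vertices from the permutation model, and let $C_k$ be the number of cycles of length $k$ in $G_n$. Let $Z_k$, $k\ge1$, be independent Poisson random variables with $\mathbf E Z_k=a(d,k)/2k$. Then $$d_{TV}\bigl((C_1,\dots,C_r),(Z_1,\dots,Z_r)\bigr)\le\frac{c\,r^2(2d-1)^r\log(2d-1)}{n}.$$
   Context: $d_{TV}(X,Y)$ is the total variation distance between the laws of $X$ and $Y$. Permutation model: let $\pi_1,\dots,\pi_d$ be independent uniformly random permutations of $\{1,\dots,n\}$. $G_n$ is the multigraph on $\{1,\dots,n\}$ having, for each $l$ and each $i$, an edge between $i$ and $\pi_l(i)$, regarded as directed from $i$ to $\pi_l(i)$ and labeled $\pi_l$. Loops and multiple edges are allowed; a loop counts twice in the degree. Words: a word $w=w_1\cdots w_k$ in the letters $\pi_1^{\pm1},\dots,\pi_d^{\pm1}$ is cyclically reduced if $w_i\ne w_{i+1}^{-1}$ for all $i$, indices modulo $k$. $a(d,k)$ is the number of cyclically reduced words of length $k$; $a(d,k)=(2d-1)^k-1+2d$ if $k$ is even and $a(d,k)=(2d-1)^k+1$ if $k$ is odd. Cycles: a cycle of length $k$ in $G_n$ is given by distinct vertices $s_0,\dots,s_{k-1}$ (with $s_k=s_0$) and a cyclically reduced word $w_1\cdots w_k$ such that $w_i(s_{i-1})=s_i$ for all $i$ (letters viewed as permutations), where two such objects are identified if they differ only by starting vertex and direction of traversal. *)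

(* Defs.v *)
From HB Require Import structures.
From mathcomp Require Import all_boot all_order all_fingroup all_algebra finmap.
From mathcomp Require Import all_classical all_reals all_analysis.

Set Implicit Arguments.
Unset Strict Implicit.
Unset Printing Implicit Defensive.

Import Order.TTheory GRing.Theory Num.Theory.

Local Open Scope ring_scope.

HB.instance Definition _ (T : finType) := isPointed.Build (perm_type T) 1%g.
HB.instance Definition _ (T : finType) :=
  @isMeasurable.Build default_measure_display (perm_type T) discrete_measurable
    discrete_measurable0 discrete_measurableC discrete_measurableU.

Section Probability.
Local Open Scope classical_set_scope.
Local Open Scope ereal_scope.

Definition tv_dist d (T : measurableType d) (R : realType)
    (mu nu : set T -> \bar R) : \bar R :=
  ereal_sup [set `|mu A - nu A| | A in measurable].

Definition mutually_independent d (Omega : measurableType d) (R : realType)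
    (P : probability Omega R) (I : choiceType) (D : set I)
    d' (T : measurableType d') (X : I -> {RV P >-> T}) : Prop :=
  forall (J : {fset I}) (A : I -> set T),
    [set` J] `<=` D ->
    (forall j, j \in J -> measurable (A j)) ->
    P (\bigcap_(j in [set` J]) (X j @^-1` A j)) =
      \prod_(j <- J) P (X j @^-1` A j).

(* [poisson_pmf] is only meaningful for a positive rate; a(d,k)/2k is positive. *)
Definition is_poisson d (Omega : measurableType d) (R : realType)
    (P : probability Omega R) (X : {RV P >-> nat}) (rate : R) : Prop :=
  forall m : nat, P (X @^-1` [set m]) = (poisson_pmf rate m)%:E.

Definition permutation_model d (Omega : measurableType d) (R : realType)
    (P : probability Omega R) (q n : nat) (pi : 'I_q -> {RV P >-> 'S_n}) :
    Prop :=
  mutually_independent [set: 'I_q] pi /\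
  forall l (sigma : 'S_n), P (pi l @^-1` [set sigma]) = (n`!%:R^-1)%:E.

End Probability.

Section Words.
Variable d : nat.

(* (l, false) stands for the letter pi_l and (l, true) for pi_l^-1; these are
   formal letters, so pi_l and pi_l^-1 are always different. *)
Definition letter := ('I_d * bool)%type.

Definition inv_letter (x : letter) : letter := (x.1, ~~ x.2).

Definition word (k : nat) := {ffun 'I_k -> letter}.

(* [ordS] is the cyclic successor on ['I_k]. *)
Definition cyc_reduced k (w : word k) : bool :=
  [forall i, w i != inv_letter (w (ordS i))].

Definition num_cyc_reduced (k : nat) : nat :=
  #|[set w : word k | cyc_reduced w]|.

End Words.

Section Cycles.
Variables d n : nat.

Definition letter_perm (pi : 'I_d -> 'S_n) (x : letter d) : 'S_n :=
  if x.2 then ((pi x.1)^-1)%g else pi x.1.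

(* The multigraph G_n has one edge i -> pi_l(i), labeled l, for each l and i, so
   the family pi determines it, and steps along its edges (in either direction)
   are given by letters.  Letter [c.2 i] is the (i+1)-st letter of the word: it labels the step from
   vertex [c.1 i] to vertex [c.1 (ordS i)]. *)
Definition closed_walk (k : nat) := ({ffun 'I_k -> 'I_n} * word d k)%type.

Definition is_cycle (pi : 'I_d -> 'S_n) k (c : closed_walk k) : bool :=
  [&& injectiveb c.1, cyc_reduced c.2 &
      [forall i, letter_perm pi (c.2 i) (c.1 i) == c.1 (ordS i)]].

Definition rotate_walk k (c : closed_walk k) : closed_walk k :=
  ([ffun i => c.1 (ordS i)], [ffun i => c.2 (ordS i)]).

(* The same walk traversed backwards from the same vertex: since
   [rev_ord i = k - 1 - i], it visits s_0, s_{k-1}, ..., s_1 and reads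
   w_k^-1, ..., w_1^-1. *)
Definition reverse_walk k (c : closed_walk k) : closed_walk k :=
  ([ffun i => c.1 (ordS (rev_ord i))],
   [ffun i => inv_letter (c.2 (rev_ord i))]).

Definition same_cycle k (c c' : closed_walk k) : bool :=
  [exists j : 'I_k, (c' == iter j (@rotate_walk k) c)
                 || (c' == iter j (@rotate_walk k) (reverse_walk c))].

Lemma rotate_walk_iter k (c : closed_walk k) :
  iter k (@rotate_walk k) c = c.
Proof.
have E j : iter j (@rotate_walk k) c =
    ([ffun i => c.1 (iter j (@ordS k) i)],
     [ffun i => c.2 (iter j (@ordS k) i)]).
  elim: j => [|j IHj].
    by rewrite [LHS]surjective_pairing; congr pair; apply/ffunP => i; rewrite ffunE.
  by rewrite iterS IHj; congr pair; apply/ffunP => i; rewrite !ffunE /= -iterSr.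
have ordSk (i : 'I_k) : iter k (@ordS k) i = i.
  have V j : val (iter j (@ordS k) i) = ((i + j) %% k)%N.
    elim: j => [|j IHj] /=; first by rewrite addn0 modn_small.
    by rewrite IHj -addn1 modnDml addn1 addnS.
  by apply: val_inj; rewrite V modnDr modn_small.
rewrite E [RHS]surjective_pairing.
by congr pair; apply/ffunP => i; rewrite ffunE ordSk.
Qed.

Lemma reverse_walkK k : involutive (@reverse_walk k).
Proof.
move=> c; rewrite [RHS]surjective_pairing; congr pair; apply/ffunP => i.
  rewrite !ffunE; congr (c.1 _); apply: val_inj => /=.
  have k_gt0 : (0 < k)%N by case: k i {c} => [[]|].
  have [i0|i_gt0] := posnP i.
    by rewrite i0 subn1 prednK // modnn subn1 prednK // modnn.
  have lt_ki : (k - i < k)%N by rewrite ltn_subrL i_gt0.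
  rewrite (subnSK (ltn_ord i)) (modn_small lt_ki) (subnSK lt_ki).
  by rewrite subKn ?modn_small // ltnW.
by rewrite !ffunE rev_ordK /inv_letter /= negbK; case: (c.2 i).
Qed.

Lemma rotate_reverse_walk k (c : closed_walk k) :
  rotate_walk (reverse_walk (rotate_walk c)) = reverse_walk c.
Proof.
have E (i : 'I_k) : ordS (rev_ord (ordS i)) = rev_ord i.
  apply: val_inj => /=.
  have k_gt0 : (0 < k)%N by case: k i {c} => [[]|].
  have := ltn_ord i; rewrite leq_eqVlt => /orP[/eqP ik|ik].
    by rewrite ik modnn subn1 prednK // modnn subnn.
  rewrite (modn_small ik) subnSK // modn_small // ltn_subrL.
  by rewrite k_gt0.
by congr pair; apply/ffunP => i; rewrite !ffunE E.
Qed.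

Lemma same_cycle_equivalence k : (0 < k)%N ->
  equivalence_rel (@same_cycle k).
Proof.
move=> k_gt0; pose r := @rotate_walk k; pose v := @reverse_walk k.
have rk m c : iter (m * k) r c = c.
  by elim: m => // m IHm; rewrite mulSn iterD IHm rotate_walk_iter.
have sP c c' : reflect (exists j : nat, c' = iter j r c \/ c' = iter j r (v c))
                       (same_cycle c c').
  apply: (iffP existsP) => [[j /orP[]/eqP->]|[j H]].
  - by exists j; left.
  - by exists j; right.
  exists (Ordinal (ltn_pmod j k_gt0)) => /=.
  by case: H => ->; rewrite {1 3}(divn_eq j k) addnC iterD rk eqxx ?orbT.
have vr j c : v (iter j r c) = iter (j * k.-1) r (v c).
  elim: j => // j IHj; rewrite iterS mulSn iterD -IHj.
  have -> : v (iter j r c) = r (v (r (iter j r c))).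
    exact/esym/rotate_reverse_walk.
  by rewrite -iterSr prednK // [RHS]rotate_walk_iter.
have vK : involutive v := @reverse_walkK k.
have inv j c : iter (j * k.-1) r (iter j r c) = c.
  by rewrite -iterD -[X in (_ + X)%N]muln1 -mulnDr addn1 prednK // rk.
have refl (c : closed_walk k) : same_cycle c c by apply/sP; exists 0%N; left.
have sym (c c' : closed_walk k) : same_cycle c c' -> same_cycle c' c.
  move=> /sP[j [->|->]]; apply/sP; first by exists (j * k.-1)%N; left; rewrite inv.
  by exists j; right; rewrite vr vK -iterD addnC iterD inv.
have trans (c1 c2 c3 : closed_walk k) : same_cycle c1 c2 -> same_cycle c2 c3 -> same_cycle c1 c3.
  move=> /sP[i H1] /sP[j H2]; apply/sP.
  case: H1 H2 => -> [] ->; rewrite ?vr ?vK -iterD;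
    eexists; by [left | right].
move=> c1 c2 c3; split=> // c12; apply/idP/idP; last exact: trans.
by apply: trans; apply: sym.
Qed.

Definition num_cycles (pi : 'I_d -> 'S_n) (k : nat) : nat :=
  #|equivalence_partition (@same_cycle k)
      [set c : closed_walk k | is_cycle pi c]|.

End Cycles.

(* Main.v *)
From HB Require Import structures.
Require Import Defs.
From mathcomp Require Import all_boot all_order all_fingroup all_algebra finmap.
From mathcomp Require Import all_classical all_reals all_analysis.
From mathcomp Require Import ring lra zify.

(** Write [b] for [2 * d - 1] and [lambda_k] for [a(d,k) / 2k], which is between
    constant multiples of [b^k / k].  The proof compares the cycle counts [C]
    with the Poisson vector [Z] by interpolation (a form of Stein's method), and
    controls the counts by a switching coupling.

    Interpolation.  Fix a set [A] of count vectors.  For [0 <= th <= 1] keep each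
    of the [C_k] cycles with probability [th] and add an independent
    Poisson([(1 - th) lambda_k]) number of new ones; the probability of landing
    in [A] is the law of [Z] at [th = 0] and the law of [C] at [th = 1]
    ([thinned_law], [smoothed]).  Its derivative in [th] is
    [sum_k E (C_k G_k(C - e_k) - lambda_k G_k(C))], where [G_k] is the increment
    of the smoothed indicator in direction [k] ([is_derive_smoothed]).  The
    Poisson noise makes the second increments of the smoothed indicator at most
    [const / (1 + (1 - th) sqrt (lambda_j lambda_k))] ([smoothed_dir2_bound]);
    integrating this over [th] costs [log (1 + L) / L] with
    [L = sqrt (lambda_j lambda_k)], which is where [r * log (2d - 1)] comes from
    ([stein_poisson_bound]).

    Switching.  The product [C_k G(C - e_k)] is a sum over the possible cycles [c]
    of length [k], so that [E (C_k G(C - e_k))] is a sum over [c] of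
    [P(c is present)] times the mean of [G] of the number of cycles other than
    [c], given that [c] is present.  Conditioning on one more edge [s -> t] of [c]
    is realised by the deterministic map [force], which composes one permutation
    with the transposition of [t] and the current image of [s]; it sends the
    uniform law to the uniform law ([force_reindex]) and affects only the cycles
    through two removed and two created edges.  The expected number of cycles
    of length [j] through a given vertex is of order [b^j / n], also when part
    of [c] is prescribed, because the last edge of such a cycle that is not
    prescribed has to hit a given vertex ([fresh_step_bound], [escaping_bound]).
    As [c] has [k] edges, conditioning on it changes the other cycle counts of
    length [j] by [O(k b^j / n)] ([stage_change], [cycle_counts_approx_identity]).

    Total.  The sum over [j, k <= r] of
    [lambda_k * k b^j / n * r log b / sqrt (lambda_j lambda_k)] is
    [O(r^2 log b / n)] times the square of [sum_(k <= r) b^(k/2)], hence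
    [O(r^2 b^r log b / n)] ([error_sum_bound]).  The estimates assume
    [n >= 4r]; otherwise the claimed bound is at least one ([one_le_error]). *)

Set Implicit Arguments.
Unset Strict Implicit.
Unset Printing Implicit Defensive.

Import Order.TTheory GRing.Theory Num.Theory.

Local Open Scope ring_scope.

(** * Poisson weights and thinned counts in one coordinate *)

Section ThinnedLaw.
Variable R : realType.
Implicit Types (f : nat -> R) (mu lam th M : R) (x z K : nat).

Definition delay f z : R := if z is z'.+1 then f z' else 0.

(** The difference is taken on the side of the law: the sum of [nabla f z * phi z]
    is the sum of [f z * (phi z.+1 - phi z)]. *)
Definition nabla f z : R := delay f z - f z.

Lemma sum_norm_delay f K : \sum_(z < K) `|delay f z| <= \sum_(z < K) `|f z|.
Proof.
case: K => [|K]; first by rewrite !big_ord0.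
rewrite big_ord_recl normr0 add0r [leRHS]big_ord_recr /= lerDl.
exact: normr_ge0.
Qed.

Definition poisson_weight mu z : R := mu ^+ z / z`!%:R * expR (- mu).

Lemma poisson_weight_ge0 mu z : 0 <= mu -> 0 <= poisson_weight mu z.
Proof. by move=> mu0; rewrite !mulr_ge0 ?exprn_ge0 ?invr_ge0 ?expR_ge0. Qed.

Lemma poisson_weightS mu z : z.+1%:R * poisson_weight mu z.+1 = mu * poisson_weight
  mu z.
Proof.
have N0 : z.+1%:R != 0 :> R by rewrite pnatr_eq0.
have F0 : z`!%:R != 0 :> R by rewrite pnatr_eq0 -lt0n fact_gt0.
rewrite /poisson_weight exprS factS natrM.
move: (expR _) (mu ^+ z) (z`!%:R) (z.+1%:R) N0 F0 => e P F N N0 F0.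
by field; rewrite N0 F0.
Qed.

Lemma sum_poisson_weight_le1 mu K : 0 <= mu -> \sum_(z < K) poisson_weight mu z <= 1.
Proof.
move=> mu0; rewrite -mulr_suml expRN ler_pdivrMr ?expR_gt0 // mul1r.
have -> : \sum_(z < K) mu ^+ z / z`!%:R = series (exp_coeff mu) K.
  by rewrite /series /= big_mkord.
apply: nondecreasing_cvgn_le; last exact: is_cvg_series_exp_coeff.
by apply: nondecreasing_series => n _ _; rewrite exp_coeff_ge0.
Qed.

Lemma sum_poisson_weight_mean mu K : 0 <= mu -> \sum_(z < K) z%:R * poisson_weight mu
  z <= mu.
Proof.
move=> mu0; case: K => [|K]; first by rewrite big_ord0.
rewrite big_ord_recl mul0r add0r.
under eq_bigr do rewrite poisson_weightS.
by rewrite -mulr_sumr ler_piMr ?sum_poisson_weight_le1.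
Qed.

(** The truncated second central moment in closed form.  The subtracted term is
    nonnegative as soon as [K >= mu], which bounds the long truncations, and the
    short ones by monotonicity. *)
Lemma sum_poisson_weight_var_eq mu K :
  \sum_(z < K) poisson_weight mu z * (z%:R - mu) ^+ 2 =
  mu * (\sum_(z < K) poisson_weight mu z) - poisson_weight mu K * K%:R * (K%:R - mu).
Proof.
elim: K => [|K IH]; first by rewrite !big_ord0; ring.
rewrite !big_ord_recr /= IH mulrDr.
rewrite [poisson_weight mu K.+1 * _]mulrC poisson_weightS -natr1; ring.
Qed.

Lemma sum_poisson_weight_var mu K : 0 <= mu ->
  \sum_(z < K) poisson_weight mu z * (z%:R - mu) ^+ 2 <= mu.
Proof.
move=> mu0; have [m Km mum] : exists2 m, (K <= m)%N & mu <= m%:R.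
  exists (maxn K (Num.truncn mu).+1); first exact: leq_maxl.
  apply: le_trans (ltW (truncnS_gt mu)) _; rewrite ler_nat; exact: leq_maxr.
apply: (@le_trans _ _ (\sum_(z < m) poisson_weight mu z * (z%:R - mu) ^+ 2)).
  rewrite -!(big_mkord xpredT (fun z => poisson_weight mu z * (z%:R - mu) ^+ 2)).
  rewrite [leRHS](@big_cat_nat _ _ _ K) //= lerDl sumr_ge0 // => i _.
  by rewrite mulr_ge0 ?poisson_weight_ge0 ?sqr_ge0.
rewrite sum_poisson_weight_var_eq.
have h1 : mu * (\sum_(z < m) poisson_weight mu z) <= mu by rewrite ler_piMr
  ?sum_poisson_weight_le1.
have h2 : 0 <= poisson_weight mu m * m%:R * (m%:R - mu).
  by rewrite mulr_ge0 ?subr_ge0 // mulr_ge0 ?poisson_weight_ge0 ?ler0n.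
by lra.
Qed.

Lemma delay_poisson_weight mu z : 0 < mu -> delay (poisson_weight mu) z =
  poisson_weight mu z * (z%:R / mu).
Proof.
move=> mu0; have mun0 := gt_eqF mu0.
case: z => [|z] /=; first by rewrite mul0r mulr0.
by rewrite mulrA [_ * z.+1%:R]mulrC poisson_weightS mulrC mulrA mulVf ?mun0 // mul1r.
Qed.

Lemma nabla_poisson_weight mu z : 0 < mu -> nabla (poisson_weight mu) z =
  poisson_weight mu z * (z%:R / mu - 1).
Proof. by move=> mu0; rewrite /nabla delay_poisson_weight // mulrBr mulr1. Qed.

Lemma nabla2_poisson_weight mu z : 0 < mu ->
  nabla (nabla (poisson_weight mu)) z = poisson_weight mu z * ((z%:R / mu - 1) ^+ 2 -
    z%:R / mu ^+ 2).
Proof.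
move=> mu0; have mun0 := gt_eqF mu0; rewrite {1}/nabla nabla_poisson_weight //.
case: z => [|z] /=; first by rewrite !mul0r; ring.
rewrite nabla_poisson_weight //.
have -> : poisson_weight mu z = poisson_weight mu z.+1 * (z.+1%:R / mu) by rewrite
  -(delay_poisson_weight z.+1).
rewrite -natr1; field; by rewrite mun0.
Qed.

(** As [nabla] multiplies the weight of [z] by [z / mu - 1], this is the mean of
    [|z / mu - 1|], at most its standard deviation. *)
Lemma sum_nabla_poisson_weight mu K : 0 < mu ->
  \sum_(z < K) `|nabla (poisson_weight mu) z| <= (Num.sqrt mu)^-1.
Proof.
move=> mu0; set s := Num.sqrt mu.
have s0 : 0 < s by rewrite sqrtr_gt0.
have sE : s ^+ 2 = mu by rewrite sqr_sqrtr // ltW.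
have weight0 z : 0 <= poisson_weight mu z by rewrite poisson_weight_ge0 // ltW.
(* the Cauchy-Schwarz inequality in the linear form |a| <= s / 2 + a^2 / (2 s) *)
apply: (@le_trans _ _ (\sum_(z < K) (poisson_weight mu z * (2 * s)^-1 +
   (poisson_weight mu z * (z%:R - mu) ^+ 2) * (2 * s ^+ 3)^-1))).
  apply: ler_sum => z _; rewrite nabla_poisson_weight // normrM ger0_norm //.
  rewrite -mulrA -mulrDr ler_wpM2l //.
  set a := z%:R - mu.
  have -> : z%:R / mu - 1 = a / s ^+ 2.
    by rewrite sE /a mulrBl divff ?gt_eqF.
  rewrite normrM [X in _ * X]ger0_norm ?invr_ge0 ?sqr_ge0 //.
  have -> : (2 * s)^-1 + a ^+ 2 / (2 * s ^+ 3) =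
     (s ^+ 2 + `|a| ^+ 2) / (2 * s) / s ^+ 2.
    by rewrite real_normK ?num_real //; field; rewrite gt_eqF.
  rewrite ler_wpM2r ?invr_ge0 ?sqr_ge0 // ler_pdivlMr ?mulr_gt0 //.
  have := sqr_ge0 (s - `|a|); nra.
rewrite big_split /=.
have h1 : (\sum_(z < K) poisson_weight mu z) / (2 * s) <= (2 * s)^-1.
  by rewrite ler_piMl ?sum_poisson_weight_le1 ?ltW // invr_gt0 mulr_gt0.
have h2 : (\sum_(z < K) poisson_weight mu z * (z%:R - mu) ^+ 2) / (2 * s ^+ 3) <= (2
  * s)^-1.
  have -> : (2 * s)^-1 = mu / (2 * s ^+ 3).
    by rewrite -sE; field; rewrite gt_eqF.
  by rewrite ler_wpM2r ?sum_poisson_weight_var ?invr_ge0 ?mulr_ge0 ?exprn_ge0 // ltW.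
rewrite !mulr_suml in h1 h2; apply: le_trans (lerD h1 h2) _.
by rewrite le_eqVlt; apply/orP; left; apply/eqP; field; rewrite gt_eqF.
Qed.

Lemma sum_nabla2_poisson_weight mu K : 0 < mu ->
  \sum_(z < K) `|nabla (nabla (poisson_weight mu)) z| <= 2 / mu.
Proof.
move=> mu0; have mun0 := gt_eqF mu0.
have weight0 z : 0 <= poisson_weight mu z by rewrite poisson_weight_ge0 // ltW.
apply: (@le_trans _ _ (\sum_(z < K) (poisson_weight mu z * (z%:R - mu) ^+ 2 * mu ^- 2 +
   z%:R * poisson_weight mu z * mu ^- 2))).
  apply: ler_sum => z _; rewrite nabla2_poisson_weight // normrM ger0_norm //.
  have -> : poisson_weight mu z * (z%:R - mu) ^+ 2 / mu ^+ 2 + z%:R * poisson_weight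
    mu z / mu ^+ 2 =
    poisson_weight mu z * ((z%:R / mu - 1) ^+ 2 + z%:R / mu ^+ 2).
    by field; rewrite mun0.
  rewrite ler_wpM2l //; apply: le_trans (ler_normB _ _) _.
  by rewrite !ger0_norm ?sqr_ge0 ?divr_ge0 ?sqr_ge0.
rewrite big_split /= -!mulr_suml -mulrDl.
have h1 := sum_poisson_weight_var K (ltW mu0); have h2 := sum_poisson_weight_mean K
  (ltW mu0).
have -> : 2 / mu = (mu + mu) / mu ^+ 2 by field; rewrite mun0.
by rewrite ler_wpM2r ?invr_ge0 ?sqr_ge0 // lerD.
Qed.

(** The law of Bin([x], [th]) + Poisson([(1 - th) lam]): each of [x] points is kept
    with probability [th].  It joins Poisson([lam]) at [th = 0] to the point mass
    at [x] at [th = 1]. *)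
Fixpoint thinned_law lam th x z {struct x} : R :=
  if x is x'.+1 then
    (1 - th) * thinned_law lam th x' z + th * delay (thinned_law lam th x') z
  else poisson_weight ((1 - th) * lam) z.

(** Increasing [x] averages the law with its delay, and averaging commutes with
    [nabla]: hence the norms of the differences are decided by the Poisson part,
    and an increment in [x] is [th] times a difference in [z]. *)
Lemma iter_nabla_thinned_law i lam th x z :
  iter i nabla (thinned_law lam th x.+1) z =
  (1 - th) * iter i nabla (thinned_law lam th x) z + th * delay (iter i nabla
    (thinned_law lam th x)) z.
Proof.
elim: i z => [//|i IH] z; rewrite !iterS /nabla; case: z => [|z] /=.
  by rewrite IH /=; ring.
by rewrite !IH /=; rewrite /nabla; ring.
Qed.

Lemma sum_iter_nabla_thinned_law i lam th M K x : 0 <= th <= 1 ->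
  \sum_(z < K) `|iter i nabla (poisson_weight ((1 - th) * lam)) z| <= M ->
  \sum_(z < K) `|iter i nabla (thinned_law lam th x) z| <= M.
Proof.
move=> /andP[th0 th1] H0; elim: x => [//|x IH].
set f := iter i nabla (thinned_law lam th x) in IH *.
apply: (@le_trans _ _ (\sum_(z < K) ((1 - th) * `|f z| + th * `|delay f z|))).
  apply: ler_sum => z _; rewrite iter_nabla_thinned_law.
  apply: le_trans (ler_normD _ _) _.
  by rewrite !normrM (ger0_norm th0) (ger0_norm (_ : 0 <= 1 - th)) ?subr_ge0.
rewrite big_split /= -!mulr_sumr.
have h1 := le_trans (sum_norm_delay f K) IH.
have h2 : (1 - th) * \sum_(z < K) `|f z| <= (1 - th) * M.
  by rewrite ler_wpM2l ?subr_ge0.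
have h3 : th * \sum_(z < K) `|delay f z| <= th * M by rewrite ler_wpM2l.
by have := lerD h2 h3; rewrite -mulrDl subrK mul1r.
Qed.

Lemma sum_norm_nabla f M K : \sum_(z < K) `|f z| <= M ->
  \sum_(z < K) `|nabla f z| <= 2 * M.
Proof.
move=> H; apply: (@le_trans _ _ (\sum_(z < K) (`|delay f z| + `|f z|))).
  by apply: ler_sum => z _; exact: ler_normB.
rewrite big_split /=; have := sum_norm_delay f K; lra.
Qed.

Lemma sum_iter_nabla_thinned_law_trivial i lam th K x : 0 <= lam -> 0 <= th <= 1 ->
  \sum_(z < K) `|iter i nabla (thinned_law lam th x) z| <= 2 ^+ i.
Proof.
move=> lam0 th01; apply: sum_iter_nabla_thinned_law => //.
elim: i => [|i IH] /=; last by rewrite exprS sum_norm_nabla.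
have mu0 : 0 <= (1 - th) * lam by case/andP: th01 => *; rewrite mulr_ge0 ?subr_ge0.
rewrite (eq_bigr (fun z : 'I_K => poisson_weight ((1 - th) * lam) z))
  ?sum_poisson_weight_le1 // => z _.
by rewrite ger0_norm ?poisson_weight_ge0.
Qed.

Lemma is_derive_poisson_weight lam th z :
  is_derive th 1 (fun t => poisson_weight ((1 - t) * lam) z)
    (- lam * nabla (poisson_weight ((1 - th) * lam)) z).
Proof.
pose g (t : R) : R := (1 - t) * lam.
have gE : g = lam \*: (cst 1 - id : R -> R).
  by apply/funext => t; rewrite /g /= mulrC.
have dg : is_derive th (1 : R) g (- lam).
  by rewrite gE; apply: is_derive_eq; rewrite sub0r /GRing.scale /= mulrN1.
have de : is_derive th (1 : R) (expR \o (- g)) (expR (- g th) * lam).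
  have dn := is_deriveN dg; rewrite opprK in dn.
  exact: (is_derive1_comp (is_derive_expR _) dn).
have fE : (fun t => poisson_weight ((1 - t) * lam) z) =
    (z`!%:R^-1) \*: (g ^+ z * (expR \o (- g)) : R -> R).
  apply/funext => t.
  rewrite [RHS](_ : _ = z`!%:R^-1 * ((g ^+ z) t * expR (- g t))) // exprfctE.
  by rewrite /poisson_weight -/(g t); ring.
rewrite fE; apply: is_derive_eq.
rewrite /GRing.scale /= -/(g th).
case: z {fE} => [|z]; rewrite /nabla /poisson_weight /= -/(g th).
  by rewrite !fctE expr0 fact0; ring.
rewrite !fctE factS natrM.
have N0 : z.+1%:R != 0 :> R by rewrite pnatr_eq0.
have F0 : z`!%:R != 0 :> R by rewrite pnatr_eq0 -lt0n fact_gt0.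
rewrite exprS.
move: (expR (- g th)) => e; move: (g th ^+ z) (g th) => P G.
move: (z`!%:R) (z.+1%:R) N0 F0 => F N N0 F0.
by field; rewrite N0 F0.
Qed.

(** The equation that makes the interpolation work: increasing [th] switches on
    each of the [x] points, with the other [x.-1] unaffected, and lowers the
    Poisson mean at rate [lam]. *)
Lemma is_derive_thinned_law lam th x z :
  is_derive th 1 (fun t => thinned_law lam t x z)
   (x%:R * nabla (thinned_law lam th x.-1) z - lam * nabla (thinned_law lam th x) z).
Proof.
elim: x z => [|x IH] z.
  by apply: is_derive_eq (is_derive_poisson_weight _ _ _) _; rewrite mul0r sub0r mulNr.
have dD : is_derive th 1 (fun t => delay (thinned_law lam t x) z)
   (delay (fun z => x%:R * nabla (thinned_law lam th x.-1) z - lam * nabla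
     (thinned_law lam th x) z) z).
  by case: z => [|z] /=; [exact: is_derive_cst|exact: IH].
have -> : (fun t => thinned_law lam t x.+1 z) =
   (cst 1 - id : R -> R) * (fun t => thinned_law lam t x z) + id * (fun t => delay
     (thinned_law lam t x) z).
  by apply/funext.
have d1 : is_derive th (1 : R) (cst 1 - id : R -> R) (0 - 1) by exact: is_deriveB.
have did := is_derive_id th (1 : R).
apply: is_derive_eq (is_deriveD (is_deriveM d1 (IH z)) (is_deriveM did dD)) _.
rewrite /GRing.scale /= !fctE.
have kS := iter_nabla_thinned_law 1 lam th x z; rewrite /= in kS.
rewrite kS.
case: x {IH dD kS} => [|x].
  by case: z => [|z] /=; rewrite /nabla /=; ring.
have := iter_nabla_thinned_law 1 lam th x z; rewrite /= => ->.
by case: z => [|z] /=; rewrite /nabla /=; rewrite -!natr1; ring.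
Qed.

Lemma thinned_law0 lam x z : thinned_law lam 0 x z = poisson_weight lam z.
Proof.
by elim: x z => [|x IH] z /=; rewrite ?IH subr0 mul1r // mul0r addr0.
Qed.

Lemma thinned_law1 lam x z : thinned_law lam 1 x z = (x == z)%:R.
Proof.
elim: x z => [|x IH] z /=.
  rewrite subrr mul0r /poisson_weight oppr0 expR0 mulr1 expr0n.
  by case: z => [|z]; rewrite ?fact0 ?divr1 // mul0r.
by rewrite subrr mul0r add0r mul1r; case: z => [|z] //=.
Qed.

End ThinnedLaw.

(** * Interpolation between a count vector and independent Poisson variables *)

Section DeriveBig.
Variable R : realType.

Lemma is_derive_bigsum (I : finType) (P : pred I) (h : I -> R -> R)
    (dh : I -> R) (t : R) :
  (forall i, is_derive t 1 (h i) (dh i)) ->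
  is_derive t 1 (fun t => \sum_(i | P i) h i t) (\sum_(i | P i) dh i).
Proof.
move=> H; have -> : (fun t => \sum_(i | P i) h i t) = \sum_(i | P i) h i.
  by apply/funext => u; rewrite fct_sumE.
by elim/big_ind2: _ => // [|f a g b fa gb]; [exact: is_derive_cst|exact: is_deriveD].
Qed.

Lemma is_derive_prod (I : finType) (f : I -> R -> R) (df : I -> R) (t : R) :
  (forall i, is_derive t 1 (f i) (df i)) ->
  is_derive t 1 (fun t => \prod_i f i t)
    (\sum_k df k * \prod_(i | i != k) f i t).
Proof.
move=> H; elim: (index_enum I) (index_enum_uniq I) => [_|a s IH /= /andP[aNs us]].
  rewrite big_nil (_ : (fun _ => _) = cst 1); first exact: is_derive_cst.
  by apply/funext => u; rewrite big_nil.
have -> : (fun t => \prod_(i <- a :: s) f i t) =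
    f a * (fun t => \prod_(i <- s) f i t).
  by apply/funext => u; rewrite big_cons.
apply: is_derive_eq (is_deriveM (H a) (IH us)) _.
rewrite /GRing.scale /= [RHS]big_cons big_cons eqxx /= addrC; congr (_ + _).
  rewrite mulrC; congr (_ * _).
  rewrite [LHS]big_seq [RHS]big_seq_cond; apply: eq_bigl => i.
  by case: (boolP (i \in s)) => //= ins; apply/esym/negP => /eqP E; rewrite -E ins in
    aNs.
rewrite mulr_sumr !big_seq; apply: eq_bigr => k ks.
rewrite big_cons ifT; first by rewrite mulrCA.
by apply/negP => /eqP E; rewrite E ks in aNs.
Qed.

Lemma derive_le0_unit_itv (f df : R -> R) :
  (forall t : R, t <= 1 -> is_derive t 1 f (df t)) ->
  (forall t : R, 0 <= t < 1 -> df t <= 0) -> f 1 <= f 0.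
Proof.
move=> fD df0.
have [t||t] := @MVT R f df 0 1 ltr01.
- by rewrite in_itv /= => /andP[_ /ltW]; exact: fD.
- apply: derivable_within_continuous => t; rewrite in_itv /= => /andP[_ t1].
  by case: (fD t t1).
rewrite in_itv /= => /andP[t0 t1] E.
by rewrite -subr_le0 E subr0 mulr1 df0 // t1 ltW.
Qed.

End DeriveBig.

Definition state (r : nat) := {ffun 'I_r -> nat}.
Definition incr r (j : 'I_r) (x : state r) : state r := [ffun i => x i + (i == j)]%N.
Definition decr r (j : 'I_r) (x : state r) : state r := [ffun i => x i - (i == j)]%N.

Section Smoothing.
Variables (R : realType) (r K : nat) (lam : 'I_r -> R).
Hypothesis lam_gt0 : forall i, 0 < lam i.
Variable A : pred {ffun 'I_r -> 'I_K}.
Implicit Types (u : 'I_r -> nat) (th : R) (x : state r).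

(** With [u = 0] this is the probability that the counts [x], thinned and
    replenished coordinatewise, land in [A]; the multi-index [u] prescribes how
    often the law of each coordinate is replaced by its difference [nabla]. *)
Definition smoothed u th x : R :=
  \sum_(z : {ffun 'I_r -> 'I_K} | A z)
     \prod_i iter (u i) (@nabla R) (thinned_law (lam i) th (x i)) (z i).

Definition dir (j i : 'I_r) : nat := (i == j).

Lemma smoothed_incr u th j x :
  smoothed u th (incr j x) - smoothed u th x = th * smoothed (fun i => dir j i + u
    i)%N th x.
Proof.
rewrite /smoothed -sumrB mulr_sumr; apply: eq_bigr => z _.
rewrite !(bigD1 j (P := predT)) //= !ffunE /dir eqxx addn1 iter_nabla_thinned_law.
have e1 : \prod_(i < r | i != j)
    iter (u i) (@nabla R) (thinned_law (lam i) th (incr j x i)) (z i) =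
    \prod_(i < r | i != j) iter (u i) (@nabla R) (thinned_law (lam i) th (x i)) (z i).
  by apply: eq_bigr => i /negbTE ij; rewrite ffunE ij addn0.
have e2 : \prod_(i < r | i != j)
    iter ((i == j) + u i) (@nabla R) (thinned_law (lam i) th (x i)) (z i) =
    \prod_(i < r | i != j) iter (u i) (@nabla R) (thinned_law (lam i) th (x i)) (z i).
  by apply: eq_bigr => i /negbTE ij; rewrite ij.
rewrite e1 e2 -[iter (true + u j) _ _ _]/(delay _ _ - iter (u j) _ _ _); ring.
Qed.

(** The sum over vectors factors over the coordinates, so bounds on the l1 norms
    of one-dimensional differences multiply. *)
Lemma smoothed_bound u th x (M : 'I_r -> R) :
  (forall i, \sum_(z < K) `|iter (u i) (@nabla R) (thinned_law (lam i) th (x i)) z|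
    <= M i) ->
  `|smoothed u th x| <= \prod_i M i.
Proof.
move=> H; apply: le_trans (ler_norm_sum _ _ _) _.
apply: (@le_trans _ _ (\sum_(z : {ffun 'I_r -> 'I_K})
   \prod_i `|iter (u i) (@nabla R) (thinned_law (lam i) th (x i)) (z i)|)).
  rewrite [leRHS](bigID A) /=; under eq_bigr do rewrite normr_prod.
  by rewrite lerDl sumr_ge0 // => z _; rewrite prodr_ge0.
rewrite -(bigA_distr_bigA (fun i (z : 'I_K) =>
   `|iter (u i) (@nabla R) (thinned_law (lam i) th (x i)) z|)).
by apply: ler_prod => i _; rewrite H andbT sumr_ge0.
Qed.

Lemma prod_at1 (k : 'I_r) (a : R) : \prod_i (if i == k then a else 1) = a.
Proof.
by rewrite (bigD1 k) //= eqxx big1 ?mulr1 // => i /negbTE ->.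
Qed.

Lemma prod_at2 (k j : 'I_r) (a b : R) : j != k ->
  \prod_i (if i == k then a else if i == j then b else 1) = a * b.
Proof.
move=> jk; rewrite (bigD1 k) //= eqxx (bigD1 j) //= (negbTE jk) eqxx.
by rewrite big1 ?mulr1 // => i /andP[/negbTE -> /negbTE ->].
Qed.

Lemma smoothed_dir_bound th k x : 0 <= th <= 1 -> `|smoothed (dir k) th x| <= 2.
Proof.
move=> th01; rewrite -[leRHS](prod_at1 k); apply: smoothed_bound => i.
apply: le_trans (sum_iter_nabla_thinned_law_trivial _ _ _ _ _) _ => //; first exact/ltW.
by rewrite /dir; case: eqP => _; rewrite ?expr1 ?expr0.
Qed.

Lemma smoothed_dir2_trivial th k j x : 0 <= th <= 1 ->
  `|smoothed (fun i => dir j i + dir k i)%N th x| <= 4.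
Proof.
move=> th01.
apply: (@le_trans _ _ (\prod_(i < r) 2 ^+ (dir j i + dir k i))).
  apply: smoothed_bound => i; apply: sum_iter_nabla_thinned_law_trivial => //;
    exact/ltW.
have -> : 4 = 2 * 2 :> R by ring.
under eq_bigr do rewrite exprD; rewrite big_split /= le_eqVlt; apply/orP; left.
have e (l : 'I_r) : \prod_(i < r) 2 ^+ dir l i = 2 :> R.
  by rewrite -[RHS](prod_at1 l); apply: eq_bigr => i _; rewrite /dir; case: eqP.
by rewrite !e.
Qed.

(** For [j != k] the two coordinates contribute one first difference each, and
    for [j = k] one coordinate contributes a second difference; both give the
    same order in [sqrt (lam k * lam j)]. *)
Lemma smoothed_dir2_smooth th k j x : 0 <= th < 1 ->
  `|smoothed (fun i => dir j i + dir k i)%N th x| <=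
  2 / ((1 - th) * Num.sqrt (lam k * lam j)).
Proof.
case/andP=> th0 th1; have th01 : 0 <= th <= 1 by rewrite th0 ltW.
have t0 : 0 < 1 - th by rewrite subr_gt0.
have mu0 i : 0 < (1 - th) * lam i by rewrite mulr_gt0.
have [->|jk] := eqVneq j k.
  rewrite -expr2 sqrtr_sqr (gtr0_norm (lam_gt0 k)) -[leRHS](prod_at1 k).
  apply: smoothed_bound => i; rewrite /dir; case: eqP => [->|_].
    by apply: sum_iter_nabla_thinned_law => //; exact: sum_nabla2_poisson_weight.
  by apply: le_trans (sum_iter_nabla_thinned_law_trivial _ _ _ _ _) _ => //; exact/ltW.
apply: (@le_trans _ _ (\prod_(i < r) (if i == k then (Num.sqrt ((1 - th) * lam k))^-1
   else if i == j then (Num.sqrt ((1 - th) * lam j))^-1 else 1))).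
  apply: smoothed_bound => i; rewrite /dir; case: (eqVneq i k) => [->|ik].
    rewrite eq_sym (negbTE jk) /=.
    by apply: (@sum_iter_nabla_thinned_law _ 1) => //; exact: sum_nabla_poisson_weight.
  case: (eqVneq i j) => [->|ij] /=.
    by apply: (@sum_iter_nabla_thinned_law _ 1) => //; exact: sum_nabla_poisson_weight.
  rewrite -[leRHS](expr0 2).
  by apply: (@sum_iter_nabla_thinned_law_trivial _ 0) => //; exact/ltW.
rewrite prod_at2 // -invfM -(sqrtrM _ (ltW (mu0 k))).
have -> : (1 - th) * lam k * ((1 - th) * lam j) = (1 - th) ^+ 2 * (lam k * lam j) by
  ring.
rewrite sqrtrM ?sqr_ge0 // sqrtr_sqr gtr0_norm //.
rewrite ler_peMl ?ler1n // invr_ge0 mulr_ge0 ?sqrtr_ge0 //; exact: ltW.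
Qed.

(** The minimum of the trivial and of the smooth bound, in a form whose primitive
    in [th] is a logarithm. *)
Lemma smoothed_dir2_bound th k j x : 0 <= th < 1 ->
  `|smoothed (fun i => dir j i + dir k i)%N th x| <=
  6 / (1 + (1 - th) * Num.sqrt (lam k * lam j)).
Proof.
move=> th01; have [th0 th1] := andP th01.
set L := Num.sqrt _; have L0 : 0 < L by rewrite sqrtr_gt0 mulr_gt0.
set w := (1 - th) * L; have w0 : 0 < w by rewrite mulr_gt0 // subr_gt0.
have w1 : 0 < 1 + w by rewrite addr_gt0.
(* the trivial bound 4 and the smooth bound 2 / w meet at w = 1/2, where both
   equal 6 / (1 + w) *)
have [wl|wl] := leP w (1 / 2).
  apply: le_trans (smoothed_dir2_trivial _ _ _ _) _; first by rewrite th0 ltW.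
  by rewrite ler_pdivlMr //; lra.
apply: le_trans (smoothed_dir2_smooth _ _ _ th01) _; rewrite -/L -/w.
by rewrite ler_pdivrMr // mulrAC ler_pdivlMr //; lra.
Qed.

Lemma is_derive_smoothed th x :
  is_derive th 1 (fun t => smoothed (fun=> 0%N) t x)
   (\sum_k ((x k)%:R * smoothed (dir k) th (decr k x) - lam k * smoothed (dir k) th x)).
Proof.
rewrite /smoothed.
have H (z : {ffun 'I_r -> 'I_K}) := is_derive_prod
   (fun i => is_derive_thinned_law (lam i) th (x i) (z i)).
apply: is_derive_eq (is_derive_bigsum A H) _.
rewrite exchange_big /=; apply: eq_bigr => k _.
rewrite !mulr_sumr -sumrB; apply: eq_bigr => z _.
have e y : (forall i, i != k -> y i = x i) ->
   \prod_(i < r) iter (dir k i) (@nabla R) (thinned_law (lam i) th (y i)) (z i) =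
   nabla (thinned_law (lam k) th (y k)) (z k) * \prod_(i < r | i != k) thinned_law
     (lam i) th (x i) (z i).
  move=> yx; rewrite (bigD1 k) //= /dir eqxx /=; congr (_ * _).
  by apply: eq_bigr => i ik; rewrite (negbTE ik) yx.
rewrite !e //; last by move=> i /negbTE ik; rewrite ffunE ik subn0.
by rewrite ffunE eqxx subn1; ring.
Qed.

End Smoothing.

Section SteinBound.
Variables (R : realType) (r K : nat) (lam : 'I_r -> R).
Hypothesis lam_gt0 : forall i, 0 < lam i.
Variables (Omega : finType) (C : Omega -> state r).
Hypothesis Omega_gt0 : (0 < #|Omega|)%N.
Hypothesis C_lt : forall w i, (C w i < K)%N.
Variables (eps : 'I_r -> R) (eta : 'I_r -> 'I_r -> R).

Hypothesis approx_identity : forall (k : 'I_r) (G : state r -> R) (b : 'I_r -> R),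
  (forall x, `|G x| <= 2) ->
  (forall x j, `|G (incr j x) - G x| <= b j) ->
  `| #|Omega|%:R^-1 *
     \sum_w ((C w k)%:R * G (decr k (C w)) - lam k * G (C w)) |
  <= 2 * eps k + \sum_j eta k j * b j.

Local Notation L k j := (Num.sqrt (lam k * lam j)).

(** If [C] satisfies the identity [E (C_k G(C - e_k)) = lam_k E (G(C))] that
    characterises independent Poisson variables, up to an error that is linear
    in the increments of [G], then [C] is close to Poisson: the derivative of the
    interpolation is at most that of [c \*: id + be], where [be] is a primitive of
    the bound on the second increments, weighted by [eta]. *)
Lemma stein_poisson_bound (A : pred {ffun 'I_r -> 'I_K}) :
  #|[set w | [exists z, A z && (C w == [ffun i => val (z i)])]]|%:R / #|Omega|%:R
   - \sum_(z : {ffun 'I_r -> 'I_K} | A z) \prod_i poisson_weight (lam i) (z i)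
  <= \sum_k (2 * eps k + \sum_j eta k j * (6 / L k j * ln (1 + L k j))).
Proof.
set N := #|Omega|%:R : R.
have N0 : 0 < N by rewrite ltr0n.
have L0 k j : 0 < L k j by rewrite sqrtr_gt0 mulr_gt0.
pose phi (t : R) : R := N^-1 * \sum_w smoothed lam A (fun=> 0%N) t (C w).
pose dphi (t : R) : R := N^-1 * \sum_w \sum_k ((C w k)%:R * smoothed lam A (dir k) t
  (decr k (C w)) -
   lam k * smoothed lam A (dir k) t (C w)).
have phiD (t : R) : is_derive t 1 phi (dphi t).
  rewrite (_ : phi = N^-1 \*: (fun t => \sum_w smoothed lam A (fun=> 0%N) t (C w))) //.
  apply: is_deriveZ; apply: is_derive_bigsum => w; exact: is_derive_smoothed.
pose be (t : R) : R := \sum_k \sum_j eta k j * (- (6 / L k j) * ln (1 + (1 - t) * L k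
  j)).
pose dbe (t : R) : R := \sum_k \sum_j eta k j * (6 / (1 + (1 - t) * L k j)).
have beD (t : R) : t <= 1 -> is_derive t 1 be (dbe t).
  move=> t1; apply: is_derive_bigsum => k; apply: is_derive_bigsum => j.
  pose g (t : R) : R := 1 + (1 - t) * L k j.
  have gE : g = cst 1 + (L k j) \*: (cst 1 - id : R -> R).
    by apply/funext => u; rewrite /g /= mulrC.
  have dg : is_derive t (1 : R) g (- L k j).
    by rewrite gE; apply: is_derive_eq; rewrite sub0r /GRing.scale /= mulrN1 add0r.
  have gt0 : 0 < g t by rewrite ltr_wpDr // mulr_ge0 ?subr_ge0 // ltW.
  have dl := is_derive1_comp (is_derive1_ln gt0) dg.
  have := is_deriveZ (eta k j * - (6 / L k j)) dl.
  rewrite (_ : _ \*: _ = (fun t => eta k j * (- (6 / L k j) * ln (g t)))); last first.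
    by apply/funext => u; rewrite /= /GRing.scale /= mulrA.
  move=> dh; apply: is_derive_eq dh _; rewrite /GRing.scale /= -/(g t).
  by field; rewrite !gt_eqF.
pose c : R := \sum_k 2 * eps k.
have bound (t : R) : 0 <= t < 1 -> dphi t <= c + dbe t.
  move=> /andP[t0 t1]; have t01 : 0 <= t <= 1 by rewrite t0 ltW.
  rewrite /dphi exchange_big /= mulr_sumr /c /dbe -big_split /=.
  apply: ler_sum => k _; apply: le_trans (ler_norm _) _.
  have := @approx_identity k (smoothed lam A (dir k) t) (fun j => 6 / (1 + (1 - t) *
    L k j)).
  apply=> [x|x j].
    exact: smoothed_dir_bound.
  rewrite smoothed_incr normrM ger0_norm //.
  apply: (@le_trans _ _ (1 * `|smoothed lam A (fun i => dir j i + dir k i)%N t x|)).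
    by rewrite ler_wpM2r // ltW.
  by rewrite mul1r; apply: smoothed_dir2_bound; rewrite ?t0.
pose psi : R -> R := phi - (c \*: id + be).
have psiD (t : R) : t <= 1 -> is_derive t 1 psi (dphi t - (c + dbe t)).
  move=> t1; apply: is_deriveB => //; apply: is_deriveD (beD _ t1).
  by apply: is_derive_eq; rewrite /GRing.scale /= mulr1.
have : psi 1 <= psi 0.
  by apply: (derive_le0_unit_itv psiD) => t t01; rewrite subr_le0 bound.
have phi0 : phi 0 = \sum_(z : {ffun 'I_r -> 'I_K} | A z) \prod_i poisson_weight (lam
  i) (z i).
  rewrite /phi; set S := RHS; rewrite (eq_bigr (fun=> S)).
    by rewrite sumr_const -[S *+ _]mulr_natl mulrA mulVf ?mul1r // gt_eqF.
  move=> w _; apply: eq_bigr => z _; apply: eq_bigr => i _ /=.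
  exact: thinned_law0.
have phi1 : phi 1 =
  #|[set w | [exists z, A z && (C w == [ffun i => val (z i)])]]|%:R / N.
  rewrite /phi mulrC; congr (_ / _).
  rewrite -sum1_card natr_sum [RHS]big_mkcond /=; apply: eq_bigr => w _; rewrite inE.
  pose z0 : {ffun 'I_r -> 'I_K} := [ffun i => Ordinal (C_lt w i)].
  have Ez (z : {ffun 'I_r -> 'I_K}) : (C w == [ffun i => val (z i)]) = (z == z0).
    apply/eqP/eqP => [E|->]; apply/ffunP => i; rewrite !ffunE //.
    by apply: val_inj; rewrite /= E ffunE.
  have -> : [exists z, A z && (C w == [ffun i => val (z i)])] = A z0.
    apply/existsP/idP => [[z]|Az0]; first by rewrite Ez => /andP[Az /eqP <-].
    by exists z0; rewrite Az0 Ez eqxx.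
  rewrite /smoothed big_mkcond (bigD1 z0) //= [X in _ + X]big1 ?addr0.
    by case: (A z0) => //; rewrite big1 // => i _; rewrite thinned_law1 ffunE eqxx.
  move=> z zz0; case: (A z) => //; apply/eqP; rewrite prodf_seq_eq0.
  have : [exists i, z i != z0 i].
    rewrite -negb_forall; apply: contra zz0 => /forallP H.
    by apply/eqP/ffunP => i; apply/eqP.
  case/existsP=> i zi; apply/hasP; exists i; first by rewrite mem_index_enum.
  rewrite thinned_law1 /= (_ : (C w i == z i) = false) // eq_sym.
  by apply/negbTE; apply: contra zi => /eqP E; rewrite ffunE -val_eqE /= E.
have psiE (t : R) : psi t = phi t - (c * t + be t) by [].
rewrite !psiE phi1 phi0.
have be1 : be 1 = 0.
  rewrite /be big1 // => k _; rewrite big1 // => j _.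
  by rewrite subrr mul0r addr0 ln1 mulr0 mulr0.
have be0 : - be 0 = \sum_k \sum_j eta k j * (6 / L k j * ln (1 + L k j)).
  rewrite /be -sumrN; apply: eq_bigr => k _; rewrite -sumrN; apply: eq_bigr => j _.
  by rewrite subr0 mul1r mulNr mulrN opprK.
rewrite be1 big_split /= -/c -be0; lra.
Qed.

End SteinBound.

(** * Switchings and the exposure of fresh edges *)

Section Switching.
Local Open Scope nat_scope.
Variables d n : nat.

Definition labelling := {ffun 'I_d -> 'S_n}.
Definition labeled_edge := ('I_n * letter d * 'I_n)%type.

Implicit Types (pi : labelling) (x z : letter d) (s t u v y : 'I_n) (e : labeled_edge)
  (F : seq labeled_edge) (w : seq (letter d)).

Definition inv_edge e : labeled_edge := (e.2, inv_letter e.1.2, e.1.1).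

Lemma inv_letterK : involutive (@inv_letter d).
Proof. by case=> l b; rewrite /inv_letter /= negbK. Qed.

Lemma inv_edgeK : involutive inv_edge.
Proof. by case=> [[s x] t]; rewrite /inv_edge /= inv_letterK. Qed.

Lemma inv_letter_neq x : (inv_letter x == x) = false.
Proof. by case: x => l b; rewrite /inv_letter xpair_eqE /= eqxx; case: b. Qed.

Definition has_edge pi e := letter_perm pi e.1.2 e.1.1 == e.2.
Definition contains F pi := all (has_edge pi) F.
(** An edge and its inverse are the same edge of the graph, traversed in the two
    directions. *)
Definition covers F e := (e \in F) || (inv_edge e \in F).

Lemma letter_perm_inv pi x s t :
  (letter_perm pi (inv_letter x) s == t) = (letter_perm pi x t == s).
Proof.
rewrite /letter_perm /inv_letter /=; case: x => l [] /=;
  by apply/eqP/eqP => <-; rewrite ?permK ?permKV.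
Qed.

Lemma has_edge_inv pi e : has_edge pi (inv_edge e) = has_edge pi e.
Proof. by rewrite /has_edge /= letter_perm_inv. Qed.

(** The image of the letter [x] is followed by the transposition of [v] and [y];
    for an inverse letter this amounts to composing its permutation on the other
    side. *)
Definition switch x v y pi : labelling :=
  [ffun l => if l == x.1 then
     (if x.2 then tperm v y * pi l else pi l * tperm v y)%g else pi l].

Lemma switch_same x v y pi s :
  letter_perm (switch x v y pi) x s = tperm v y (letter_perm pi x s).
Proof.
rewrite /letter_perm ffunE eqxx; case: x.2; last by rewrite permM.
by rewrite invMg tpermV permM.
Qed.

Lemma switch_inv x v y pi s :
  letter_perm (switch x v y pi) (inv_letter x) s =
  letter_perm pi (inv_letter x) (tperm v y s).
Proof.
rewrite /letter_perm ffunE /= eqxx; case: x.2 => /=; first by rewrite permM.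
by rewrite invMg tpermV permM.
Qed.

Lemma switch_other x v y pi z s : z != x -> z != inv_letter x ->
  letter_perm (switch x v y pi) z s = letter_perm pi z s.
Proof.
move=> zx zi; rewrite /letter_perm ffunE; case: eqP => // zx1.
case: z x zx zi zx1 => [l b] [l' b'] /= + + E.
by rewrite /inv_letter !xpair_eqE /= E !eqxx /=; case: b; case: b'.
Qed.

Lemma switchK x v y : involutive (switch x v y).
Proof.
move=> pi; apply/ffunP => l; rewrite !ffunE; case: eqP => // _.
by case: x.2; rewrite ?mulgA -?mulgA ?tperm2 ?mulg1 // mulgA tperm2 mul1g.
Qed.

(** The vertices at which the edges of [F], in either direction, arrive by the
    letter [x]; a switch at [x] of two other vertices leaves [F] in place. *)
Definition heads x F := [seq e.2 | e <- F & e.1.2 == x] ++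
  [seq e.1.1 | e <- F & e.1.2 == inv_letter x].

Lemma size_heads x F : size (heads x F) <= size F.
Proof.
rewrite size_cat !size_map; elim: F => //= e F IH.
case: eqP => [->|_]; first by rewrite eq_sym inv_letter_neq.
by case: ifP => _ //=; [rewrite addnS ltnS|exact: leq_trans IH _].
Qed.

Lemma mem_heads x F v :
  (v \in heads x F) = has (fun e => (e.1.2 == x) && (e.2 == v) ||
    (e.1.2 == inv_letter x) && (e.1.1 == v)) F.
Proof.
rewrite mem_cat; elim: F => //= e F <-.
by case: (_ == x); case: (_ == inv_letter x); rewrite /= ?inE ?(eq_sym v);
  case: (e.2 == v); case: (e.1.1 == v); rewrite /= ?orbT.
Qed.

Lemma switch_has_edge x v y pi e :
  v \notin heads x [:: e] -> y \notin heads x [:: e] ->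
  has_edge pi e -> has_edge (switch x v y pi) e.
Proof.
rewrite !mem_heads /= !orbF !negb_or !negb_and /has_edge.
case: e => [[s z] t] /= /andP[v1 v2] /andP[y1 y2] /eqP E; apply/eqP.
have [zx|zx] := eqVneq z x.
  rewrite zx in E v1 y1 *; rewrite !eqxx /= in v1 y1.
  by rewrite switch_same E tpermD // eq_sym.
have [zi|zi] := eqVneq z (inv_letter x).
  rewrite zi in E v2 y2 *; rewrite !eqxx /= in v2 y2.
  by rewrite switch_inv tpermD ?E // eq_sym.
by rewrite switch_other.
Qed.

Lemma mem_heads_cons x F v e :
  e \in F -> v \notin heads x F -> v \notin heads x [:: e].
Proof.
rewrite !mem_heads => eF /hasPn /(_ _ eF) H; apply/hasPn => e'.
by rewrite inE => /eqP ->.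
Qed.

Lemma contains_switch x v y F pi :
  v \notin heads x F -> y \notin heads x F ->
  contains F (switch x v y pi) = contains F pi.
Proof.
move=> vF yF.
have H pi' : contains F pi' -> contains F (switch x v y pi').
  move=> /allP C; apply/allP => e eF.
  by apply: switch_has_edge; rewrite ?(mem_heads_cons eF) // C.
by apply/idP/idP => [/H|/H //]; rewrite switchK.
Qed.

Fixpoint trail pi u w : seq labeled_edge :=
  if w is x :: w' then (u, x, letter_perm pi x u) :: trail pi (letter_perm pi x u) w'
  else [::].

Definition endpoint pi u w := foldl (fun s x => letter_perm pi x s) u w.

Lemma size_trail pi u w : size (trail pi u w) = size w.
Proof. by elim: w u => //= x w IH u; rewrite IH. Qed.

Lemma trail_rcons pi u w x : trail pi u (rcons w x) =
  rcons (trail pi u w) (endpoint pi u w, x, letter_perm pi x (endpoint pi u w)).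
Proof. by elim: w u => //= z w IH u; rewrite IH. Qed.

Lemma endpoint_rcons pi u w x :
  endpoint pi u (rcons w x) = letter_perm pi x (endpoint pi u w).
Proof. by rewrite /endpoint -cats1 foldl_cat. Qed.

Lemma contains_trail pi u w : contains (trail pi u w) pi.
Proof. by elim: w u => //= x w IH u; rewrite /has_edge eqxx IH. Qed.

Lemma trail_eq pi pi' u w : contains (trail pi u w) pi' ->
  trail pi' u w = trail pi u w /\ endpoint pi' u w = endpoint pi u w.
Proof.
elim: w u => //= x w IH u /andP[/eqP /= E /IH[E1 E2]].
by rewrite /endpoint /= E E1; split.
Qed.

Lemma card_notin (l : seq 'I_n) : n - size l <= #|[pred y | y \notin l]|.
Proof.
have := cardC (mem l); rewrite card_ord => H.
have : #|mem l| <= size l by exact: card_size.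
have -> : #|[pred y | y \notin l]| = #|predC (mem l)| by apply: eq_card.
by move=> sl; rewrite leq_subLR -[leqLHS]H leq_add2r.
Qed.

Definition num_containing F := #|[set pi | contains F pi]|.

(** The last step of a walk, if its edge has not been exposed before, is uniform
    over the vertices that are still free, so it hits [v] with probability at
    most one over their number.  Switching [v] with any free vertex [y] keeps
    [F] and the first steps and sends the last step to [y], so that [y] and the
    original labelling can be recovered from the result. *)
Lemma fresh_step_bound F u w x v :
  #|[set pi | [&& contains F pi, endpoint pi u (rcons w x) == v &
     ~~ covers (F ++ trail pi u w) (endpoint pi u w, x, v)]]|
  * (n - size F - size w) <= num_containing F.
Proof.
set B := [set pi | _].
pose H pi := heads x (F ++ trail pi u w).
pose D := [set p : labelling * 'I_n | (p.1 \in B) && (p.2 \notin H p.1)].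
apply: (@leq_trans #|D|).
  rewrite -sum_nat_const -sum1_card.
  apply: (@leq_trans (\sum_(pi in B) \sum_(y | y \notin H pi) 1)).
    apply: leq_sum => pi _; rewrite sum1_card.
    apply: leq_trans (card_notin _); rewrite -subnDA leq_sub2l //.
    by apply: leq_trans (size_heads _ _) _; rewrite size_cat size_trail.
  by rewrite pair_big_dep /=; apply: eq_leq; apply: eq_bigl => -[pi y]; rewrite
    [RHS]inE.
have key p : p \in D -> [/\ contains F p.1,
    letter_perm p.1 x (endpoint p.1 u w) = v,
    contains (F ++ trail p.1 u w) (switch x v p.2 p.1) &
    endpoint (switch x v p.2 p.1) u w = endpoint p.1 u w].
  case: p => pi y; rewrite inE /= inE => /andP[/and3P[FC /eqP]].
  rewrite endpoint_rcons => Ev nc yH.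
  have C : contains (F ++ trail pi u w) pi.
    by rewrite /contains all_cat [all _ F]FC [all _ _](contains_trail pi).
  have vH : v \notin H pi.
    rewrite mem_heads; apply/hasPn => -[[s z] t] eF /=; apply/negP => Hv.
    move: nc; rewrite /covers /inv_edge /= negb_or => /andP[/negP n1 /negP n2].
    have := allP C _ eF; rewrite /has_edge /= => /eqP E.
    case/orP: Hv => /andP[/eqP zx /eqP vt]; subst z.
      apply: n1; suff -> : endpoint pi u w = s by rewrite -vt.
      by apply: (@perm_inj _ (letter_perm pi x)); rewrite Ev E.
    apply: n2; rewrite -vt; suff -> : endpoint pi u w = t by [].
    move/eqP: E; rewrite letter_perm_inv => /eqP E.
    by apply: (@perm_inj _ (letter_perm pi x)); rewrite Ev E.
  have C' : contains (F ++ trail pi u w) (switch x v y pi) by rewrite contains_switch.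
  split=> //; have : contains (trail pi u w) (switch x v y pi).
    by move: C'; rewrite /contains all_cat => /andP[].
  by case/trail_eq.
pose f (p : labelling * 'I_n) := switch x v p.2 p.1.
have fe p : p \in D -> endpoint (f p) u (rcons w x) = p.2.
  by move=> /key[_ E _ E2]; rewrite endpoint_rcons /f E2 switch_same E tpermL.
have finj : {in D &, injective f}.
  move=> p q pD qD E; have E2 : p.2 = q.2 by rewrite -(fe p) // -(fe q) // E.
  rewrite [p]surjective_pairing [q]surjective_pairing E2; congr (_, _).
  by rewrite -(switchK x v p.2 p.1) -/(f p) E /f E2 switchK.
rewrite -(card_in_imset finj); apply: subset_leq_card; apply/fintype.subsetP => pi'.
case/imsetP => p /key[_ _ + _] ->; rewrite inE /contains all_cat.
by case/andP.
Qed.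

Fixpoint words j : seq (seq (letter d)) :=
  if j is j'.+1 then [seq rcons w x | w <- words j', x <- enum {: letter d}]
  else [:: [::]].

Lemma big_words j (f : seq (letter d) -> nat) :
  \sum_(w <- words j.+1) f w = \sum_(w <- words j) \sum_x f (rcons w x).
Proof.
by rewrite /= big_allpairs_dep; apply: eq_bigr => w _; rewrite big_enum.
Qed.

Lemma mem_words w : w \in words (size w).
Proof.
elim/last_ind: w => [|w x IH]; first by rewrite inE.
by rewrite size_rcons; apply/allpairsP; exists (w, x); rewrite /= mem_enum.
Qed.

Lemma uniq_words j : uniq (words j).
Proof.
elim: j => //= j IH; apply: allpairs_uniq => //; first exact: enum_uniq.
by case=> w x [w' x'] _ _ /= /rcons_inj[-> ->].
Qed.

Lemma size_words j w : w \in words j -> size w = j.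
Proof.
elim: j w => [|j IH] w /=; first by rewrite inE => /eqP ->.
by case/allpairsP => -[w' x] /= [/IH E _ ->]; rewrite size_rcons E.
Qed.

Definition reduced w := sorted (fun x z => z != inv_letter x) w.

Lemma reduced_rcons2 w x z :
  reduced (rcons (rcons w x) z) = reduced (rcons w x) && (z != inv_letter x).
Proof.
rewrite /reduced; case: w => [|y w] //=; first by rewrite andbT.
by rewrite rcons_path last_rcons.
Qed.

Lemma card_neq_letter x : \sum_z (z != inv_letter x : nat) = 2 * d - 1.
Proof.
rewrite -big_mkcond sum1_card /= cardC1 card_prod card_ord card_bool.
by rewrite mulnC subn1.
Qed.

Lemma num_reduced j :
  \sum_(w <- words j.+1) reduced w = 2 * d * (2 * d - 1) ^ j.
Proof.
elim: j => [|j IH].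
  rewrite big_words /= big_seq1 expn0 muln1 /=.
  by rewrite sum1_card card_prod card_ord card_bool mulnC.
rewrite big_words expnSr mulnA -IH big_distrl big_seq [RHS]big_seq; apply: eq_bigr =>
  w /size_words.
case/lastP: w => [//|w x] _.
under eq_bigr do rewrite reduced_rcons2.
by case: (reduced _) => /=; [rewrite card_neq_letter mul1n | rewrite big1].
Qed.

Definition fresh (E : seq labeled_edge) :=
  pairwise (fun e e' => (e' != e) && (inv_edge e' != e)) E.

Lemma fresh_rcons E e : fresh (rcons E e) -> fresh E && ~~ covers E e.
Proof.
rewrite /fresh pairwise_rcons => /andP[/allP H ->]; rewrite /covers negb_or /=.
by apply/andP; split; apply/negP => /H; rewrite eqxx ?andbF.
Qed.

(** The walk [w] from [u] to [v] is a potential part of a cycle that is not made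
    of edges of [F] alone. *)
Definition escaping F pi u v w :=
  [&& endpoint pi u w == v, reduced w, fresh (trail pi u w) &
      has (predC (covers F)) (trail pi u w)].

Definition indegree_le2 F :=
  forall v, #|[set p : 'I_n * letter d | covers F (p.1, p.2, v)]| <= 2.

(** Peel off the last letter.  If its edge belongs to [F], there are at most two
    choices for it and the shorter walk still escapes; otherwise the edge is
    fresh and [fresh_step_bound] applies to each of the [2d (2d-1)^j] reduced
    words.  The expected number [a_j] of walks, multiplied by the number of free
    vertices, then satisfies [a_(j+1) <= 2 a_j + 2d (2d-1)^j], and [4 (2d-1)^j]
    is a supersolution for [d >= 2]. *)
Lemma escaping_bound F u j v : 2 <= d -> indegree_le2 F ->
  (\sum_(pi | contains F pi) \sum_(w <- words j) escaping F pi u v w)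
    * (n - size F - j)
  <= num_containing F * (4 * (2 * d - 1) ^ j).
Proof.
move=> d2 degF; set N := num_containing F.
elim: j v => [|j IH] v.
  by rewrite big1 // => pi _; rewrite big_seq1 /escaping /= !andbF.
set M := n - size F - j.+1.
have M1 : M <= n - size F - j by rewrite /M; lia.
pose cl (p : 'I_n * letter d) := covers F (p.1, p.2, v).
pose fr pi w x := [&& endpoint pi u (rcons w x) == v &
     ~~ covers (F ++ trail pi u w) (endpoint pi u w, x, v)].
have split_esc pi w x : escaping F pi u v (rcons w x) <=
    (cl (endpoint pi u w, x) && escaping F pi u (endpoint pi u w) w)
    + (reduced (rcons w x) && fr pi w x).
  rewrite /escaping trail_rcons has_rcons endpoint_rcons /fr endpoint_rcons /cl /=.
  case: eqP => //= ->; rewrite eqxx /=.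
  case red: (reduced _) => //=.
  have -> /= : reduced w.
    case/lastP: w red => // w z; rewrite reduced_rcons2 => /andP[//].
  case fr1: (fresh (rcons _ _)) => //=.
  have /andP[-> /=] := fresh_rcons fr1.
  rewrite /covers !mem_cat => nc.
  move: nc; rewrite negb_or => /andP[/negbTE -> /negbTE ->]; rewrite !orbF.
  by case: (_ \in F); case: (_ \in F); case: has.
set S := (\sum_(pi | _) _).
have SB : S <= \sum_(p | cl p) (\sum_(pi | contains F pi) \sum_(w <- words j)
  escaping F pi u p.1 w)
   + \sum_(w <- words j) \sum_x (reduced (rcons w x) *
       #|[set pi | contains F pi && fr pi w x]|).
  rewrite [X in _ <= X + _]exchange_big /=.
  have -> : \sum_(w <- words j) \sum_x reduced (rcons w x) *
      #|[set pi | contains F pi && fr pi w x]| =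
     \sum_(pi | contains F pi) \sum_(w <- words j) \sum_x (reduced (rcons w x) && fr
       pi w x).
    rewrite [RHS]exchange_big /=; apply: eq_bigr => w _.
    rewrite [RHS]exchange_big /=; apply: eq_bigr => x _.
    rewrite -sum1_card big_distrr /= big_mkcond [RHS]big_mkcond /=.
    apply: eq_bigr => pi _; rewrite inE.
    by case: contains; case: reduced; case: (fr _ _ _).
  rewrite -big_split /=; apply: leq_sum => pi _; rewrite big_words.
  rewrite [X in _ <= X + _]exchange_big /= -big_split /=; apply: leq_sum => w _.
  apply: (@leq_trans (\sum_x ((cl (endpoint pi u w, x) && escaping F pi u (endpoint
    pi u w) w)
    + (reduced (rcons w x) && fr pi w x)))); first exact: leq_sum.
  rewrite big_split /= leq_add2r.
  apply: (@leq_trans (\sum_s \sum_x (if cl (s, x) then escaping F pi u s w : nat else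
    0))).
    rewrite [leqRHS](bigD1 (endpoint pi u w)) //=; apply: leq_trans (leq_addr _ _).
    by apply: leq_sum => x _; case: (cl _).
  rewrite pair_bigA [leqRHS]big_mkcond /=; apply: eq_leq.
  by apply: eq_bigr => -[s x].
have H1 : (\sum_(p | cl p) (\sum_(pi | contains F pi) \sum_(w <- words j) escaping F
  pi u p.1 w)) * M
   <= 2 * (N * (4 * (2 * d - 1) ^ j)).
  rewrite big_distrl /=.
  apply: (@leq_trans (\sum_(p | cl p) N * (4 * (2 * d - 1) ^ j))).
    by apply: leq_sum => p _; apply: leq_trans (IH p.1); rewrite leq_mul2l M1 orbT.
  rewrite sum_nat_const leq_mul2r; apply/orP; right.
  by apply: leq_trans (degF v); rewrite cardsE.
have H2 : (\sum_(w <- words j) \sum_x (reduced (rcons w x) *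
       #|[set pi | contains F pi && fr pi w x]|)) * M <= (2 * d * (2 * d - 1) ^ j) * N.
  rewrite -num_reduced big_words !big_distrl /= big_seq [leqRHS]big_seq.
  apply: leq_sum => w /size_words sw; rewrite !big_distrl /=; apply: leq_sum => x _.
  rewrite -mulnA leq_mul2l; apply/orP; right.
  apply: leq_trans (fresh_step_bound F u w x v); rewrite sw leq_mul //.
apply: leq_trans (leq_mul SB (leqnn M)) _; rewrite mulnDl.
apply: leq_trans (leq_add H1 H2) _.
have -> : 2 * (N * (4 * (2 * d - 1) ^ j)) + 2 * d * (2 * d - 1) ^ j * N =
   (N * (2 * d - 1) ^ j) * (8 + 2 * d) by ring.
rewrite expnS; set X := _ ^ j.
have -> : N * (4 * ((2 * d - 1) * X)) = (N * X) * (4 * (2 * d - 1)) by ring.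
by rewrite leq_mul2l; apply/orP; right; lia.
Qed.

End Switching.

(** * Closed walks, their edges and their classes *)

Section CycleWalks.
Local Open Scope nat_scope.
Variables d n : nat.
Notation labelling := (labelling d n).
Notation labeled_edge := (labeled_edge d n).
Notation walk k := (closed_walk d n k.+1).
Implicit Types (pi : labelling) (k j : nat) (F : seq labeled_edge).

(** Positions along a cycle indexed by all natural numbers, so that the successor
    of a position is definitionally [ordS]. *)
Definition pos k i : 'I_k.+1 := iter i (@ordS k.+1) ord0.

Lemma val_pos k i : val (pos k i) = i %% k.+1.
Proof.
elim: i => [|i IH] /=; first by rewrite mod0n.
by rewrite -[nat_of_ord _]/(val (pos k i)) IH -addn1 modnDml addn1.
Qed.

Lemma pos_ord k (i : 'I_k.+1) : pos k i = i.
Proof. by apply: val_inj; rewrite val_pos modn_small. Qed.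

Lemma pos_inj k i j : i < k.+1 -> j < k.+1 -> pos k i = pos k j -> i = j.
Proof. by move=> ik jk /(congr1 val); rewrite !val_pos !modn_small. Qed.

Definition edge k (c : walk k) (i : 'I_k.+1) : labeled_edge := (c.1 i, c.2 i, c.1
  (ordS i)).
Definition edges k (c : walk k) : seq labeled_edge := [seq edge c (pos k i) | i <-
  iota 0 k.+1].
Definition letters k (c : walk k) := [seq c.2 (pos k i) | i <- iota 0 k.+1].
(** The walks that are cycles of some labelling, see [is_cycleE]. *)
Definition valid k (c : walk k) := injectiveb c.1 && cyc_reduced c.2.

Lemma size_edges k (c : walk k) : size (edges c) = k.+1.
Proof. by rewrite size_map size_iota. Qed.

Lemma nth_edges k (c : walk k) e0 i : i < k.+1 -> nth e0 (edges c) i = edge c (pos k i).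
Proof. by move=> ik; rewrite (nth_map 0) ?size_iota // nth_iota. Qed.

Lemma mem_edges k (c : walk k) i : edge c i \in edges c.
Proof. by apply/mapP; exists (val i); rewrite ?mem_iota ?pos_ord /=. Qed.

Lemma edgesP k (c : walk k) e : reflect (exists i, e = edge c i) (e \in edges c).
Proof.
by apply: (iffP mapP) => [[i _ ->]|[i ->]]; [exists (pos k i)|apply/mapP; exact:
  mem_edges].
Qed.

Lemma mem_take_edges k (c : walk k) a e : e \in take a (edges c) ->
  exists2 i, i < a & i < k.+1 /\ e = edge c (pos k i).
Proof.
move=> H; have e0 := e; case/(nthP e0): H => i; rewrite size_take_min size_edges
  leq_min.
by case/andP=> ia ik; rewrite nth_take // nth_edges // => <-; exists i.
Qed.

Lemma is_cycleE pi k (c : walk k) : is_cycle pi c = valid c && contains (edges c) pi.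
Proof.
rewrite /is_cycle /valid -andbA; congr [&& _, _ & _].
apply/forallP/allP => [H e /edgesP[i ->]|H i]; first exact: H.
exact: (H _ (mem_edges c i)).
Qed.

Lemma valid_inj k (c : walk k) : valid c -> injective c.1.
Proof. by case/andP=> /injectiveP. Qed.

Lemma valid_reduced k (c : walk k) i : valid c -> c.2 i != inv_letter (c.2 (ordS i)).
Proof. by case/andP=> _ /forallP. Qed.

(** If a valid walk traversed an edge in both directions, distinctness of the
    vertices would make the two steps consecutive, against cyclic reducedness. *)
Lemma edge_inv_neq k (c : walk k) (i j : 'I_k.+1) : valid c -> inv_edge (edge c i) !=
  edge c j.
Proof.
move=> vc; have inj := valid_inj vc; apply: contra (valid_reduced i vc) => /eqP[/inj
  <- <- _].
by rewrite inv_letterK.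
Qed.

Lemma fresh_edges k (c : walk k) : valid c -> fresh (edges c).
Proof.
move=> vc; rewrite /fresh pairwise_map.
have := iota_ltn_sorted 0 k.+1; rewrite sorted_pairwise; last exact: ltn_trans.
apply: (@sub_in_pairwise _ (fun i => i < k.+1)); last first.
  by apply/allP => i; rewrite mem_iota.
move=> i i' ik i'k ii' /=; rewrite edge_inv_neq // andbT.
apply/negP => /eqP[/(valid_inj vc) E _ _].
by move: ii'; rewrite (pos_inj i'k ik E) /= ltnn.
Qed.

Lemma trail_steps pi (s : nat -> 'I_n) (w : nat -> letter d) m k :
  (forall i, letter_perm pi (w i) (s i) = s i.+1) ->
  trail pi (s m) [seq w i | i <- iota m k] = [seq (s i, w i, s i.+1) | i <- iota m k]
  /\ endpoint pi (s m) [seq w i | i <- iota m k] = s (m + k).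
Proof.
move=> H; elim: k m => [|k IH] m /=; first by rewrite addn0.
have [E1 E2] := IH m.+1; rewrite /endpoint in E2 *.
by rewrite /= H E1 E2 addSnnS.
Qed.

Lemma trail_letters pi k (c : walk k) : is_cycle pi c ->
  trail pi (c.1 ord0) (letters c) = edges c /\
  endpoint pi (c.1 ord0) (letters c) = c.1 ord0.
Proof.
case/and3P=> _ _ /forallP H.
have [|-> ->] := @trail_steps pi (fun i => c.1 (pos k i)) (fun i => c.2 (pos k i)) 0
  k.+1.
  by move=> i; apply/eqP; exact: H.
split=> //; rewrite add0n; congr (c.1 _); apply: val_inj.
by rewrite val_pos modnn.
Qed.

Lemma reduced_letters k (c : walk k) : valid c -> reduced (letters c).
Proof.
case/andP=> _ /forallP H; apply/(sortedP (c.2 ord0)) => i.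
rewrite size_map size_iota => ik; rewrite !(nth_map 0) ?size_iota //; last exact: ltnW.
rewrite !nth_iota //; last exact: ltnW.
have := H (pos k i); apply: contra => /eqP E; apply/eqP.
by rewrite -[ordS _]/(pos k i.+1) -[i.+1]add0n E inv_letterK.
Qed.

Definition inside F j (b : walk j) := all (covers F) (edges b).

(** Cycles are counted through a vertex by closed walks starting there, which are
    determined by their words. *)
Definition rooted pi F u j : {set walk j} :=
  [set b | [&& is_cycle pi b, b.1 ord0 == u & ~~ inside F b]].

Lemma card_rooted pi F E u j : (forall e, covers F e -> covers E e) ->
  #|rooted pi E u j| <= \sum_(w <- words d j.+1) escaping F pi u u w.
Proof.
move=> FE.
have -> : \sum_(w <- words d j.+1) escaping F pi u u w =
    size [seq w <- words d j.+1 | escaping F pi u u w].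
  by rewrite size_filter -sum1_count [RHS]big_mkcond /=; apply: eq_bigr => w _; case:
    escaping.
rewrite cardE -(size_map (@letters j)); apply: uniq_leq_size.
  rewrite map_inj_in_uniq ?enum_uniq // => b b'; rewrite !mem_enum !inE.
  case/and3P=> cb /eqP ub _ /and3P[cb' /eqP ub' _] Eb.
  have [E1 _] := trail_letters cb; have [E2 _] := trail_letters cb'.
  rewrite ub Eb in E1; rewrite ub' E1 in E2.
  have H i : edge b i = edge b' i.
    by have := congr1 (fun s => nth (edge b i) s i) E2; rewrite /= !nth_edges //
      pos_ord.
  rewrite [b]surjective_pairing [b']surjective_pairing; congr pair; apply/ffunP => i;
    by have [] := H i.
move=> w /mapP[b]; rewrite mem_enum inE => /and3P[cb /eqP ub ins] ->.
rewrite mem_filter; apply/andP; split; last first.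
  by rewrite -[X in words d X](size_iota 0 j.+1) -(size_map (fun i => b.2 (pos j i)))
    mem_words.
have [E1 E2] := trail_letters cb; have vb : valid b by move: cb; rewrite is_cycleE =>
  /andP[].
rewrite /escaping -ub E1 E2 eqxx reduced_letters // fresh_edges //=.
move: ins; rewrite -has_predC; apply: sub_has => e /=; apply: contra; exact: FE.
Qed.

(** A vertex has at most one edge of [c] before it and at most one after it. *)
Lemma indegree_edges k (c : walk k) a : valid c -> indegree_le2 (take a (edges c)).
Proof.
move=> vc v; have inj := valid_inj vc.
have [i0 Hi0] : exists i0, forall i, c.1 (ordS i) = v -> i = i0.
  have [i1|N] := pickP (fun i => c.1 (ordS i) == v).
    move/eqP => E1; exists i1 => i E; apply: (can_inj (@ordSK k.+1)); apply: inj.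
    by rewrite E E1.
  by exists ord0 => i E; move: (N i); rewrite E eqxx.
have [i1 Hi1] : exists i1, forall i, c.1 i = v -> i = i1.
  have [i1|N] := pickP (fun i => c.1 i == v).
    by move/eqP => E1; exists i1 => i E; apply: inj; rewrite E E1.
  by exists ord0 => i E; move: (N i); rewrite E eqxx.
apply: leq_trans (_ : #|[set (c.1 i0, c.2 i0); (c.1 (ordS i1), inv_letter (c.2 i1))]|
  <= 2);
  last by rewrite cards2; case: (_ != _).
apply: subset_leq_card; apply/fintype.subsetP => -[s x]; rewrite !inE /covers
  /inv_edge /=.
case/orP=> /mem_take_edges[i _ [_]].
  by case=> -> -> /esym /Hi0 ->; rewrite eqxx.
by case=> /esym /Hi1 -> E ->; rewrite -E inv_letterK eqxx orbT.
Qed.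

(** The edges of a valid walk can be prescribed successively: no letter is given
    two images or two preimages. *)
Lemma heads_take_edges k (c : walk k) a : valid c -> a < k.+1 ->
  let e := edge c (pos k a) in
  e.2 \notin heads e.1.2 (take a (edges c)) /\
  e.1.1 \notin heads (inv_letter e.1.2) (take a (edges c)).
Proof.
move=> vc ak e; have inj := valid_inj vc.
split; rewrite mem_heads; apply/hasPn => _ /mem_take_edges[i ia [ik ->]] /=;
  rewrite ?inv_letterK; apply/negP; case/orP=> /andP[/eqP E1 /eqP E2].
- have E : pos k i = pos k a by apply: (can_inj (@ordSK k.+1)); apply: inj.
  by move: ia; rewrite (pos_inj ik ak E) ltnn.
- have E : pos k i = ordS (pos k a) by apply: inj.
  by have := valid_reduced (pos k a) vc; rewrite -E E1 inv_letterK eqxx.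
- have E : ordS (pos k i) = pos k a by apply: inj.
  by have := valid_reduced (pos k i) vc; rewrite E E1 eqxx.
- have E : pos k i = pos k a by apply: inj.
  by move: ia; rewrite (pos_inj ik ak E) ltnn.
Qed.

Lemma edge_rotate k (c : walk k) i : edge (rotate_walk c) i = edge c (ordS i).
Proof. by rewrite /edge /= !ffunE. Qed.

Lemma ordS_rev_ordS k (i : 'I_k.+1) : ordS (rev_ord (ordS i)) = rev_ord i.
Proof.
apply: val_inj => /=; have := ltn_ord i; rewrite leq_eqVlt => /orP[/eqP ik|ik].
  by rewrite ik modnn subn1 /= modnn subnn.
by rewrite (modn_small ik) subnSK // modn_small // ltn_subrL.
Qed.

Lemma edge_reverse k (c : walk k) i :
  edge (reverse_walk c) i = inv_edge (edge c (rev_ord i)).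
Proof. by rewrite /edge /inv_edge /= !ffunE ordS_rev_ordS. Qed.

Lemma covers_edges k (c : walk k) e :
  covers (edges c) e = [exists i, (e == edge c i) || (inv_edge e == edge c i)].
Proof.
apply/orP/existsP => [[/edgesP[i ->]|/edgesP[i ->]]|[i /orP[/eqP ->|/eqP ->]]].
- by exists i; rewrite eqxx.
- by exists i; rewrite eqxx orbT.
- by left; exact: mem_edges.
- by right; exact: mem_edges.
Qed.

Lemma covers_rotate k (c : walk k) : covers (edges (rotate_walk c)) =1 covers (edges c).
Proof.
move=> e; rewrite !covers_edges; apply/existsP/existsP => -[i].
  by rewrite edge_rotate; exists (ordS i).
by move=> H; exists (ord_pred i); rewrite edge_rotate ord_predK.
Qed.

Lemma covers_reverse k (c : walk k) : covers (edges (reverse_walk c)) =1 covers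
  (edges c).
Proof.
have H e i : (e == edge c i) || (inv_edge e == edge c i) =
   (e == inv_edge (edge c i)) || (inv_edge e == inv_edge (edge c i)).
  by rewrite (inj_eq (can_inj (@inv_edgeK d n))) (can2_eq (@inv_edgeK d n)
    (@inv_edgeK d n)) orbC.
move=> e; rewrite !covers_edges; apply/existsP/existsP => -[i].
  by rewrite edge_reverse -H; exists (rev_ord i).
by move=> Hi; exists (rev_ord i); rewrite edge_reverse rev_ordK -H.
Qed.

Lemma valid_rotate k (c : walk k) : valid c -> valid (rotate_walk c).
Proof.
move=> vc; have inj := valid_inj vc; apply/andP; split.
  by apply/injectiveP => i j; rewrite !ffunE => /inj /(can_inj (@ordSK k.+1)).
by apply/forallP => i; rewrite !ffunE; exact: valid_reduced.
Qed.

Lemma valid_reverse k (c : walk k) : valid c -> valid (reverse_walk c).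
Proof.
move=> vc; have inj := valid_inj vc; apply/andP; split.
  apply/injectiveP => i j; rewrite !ffunE => /inj /(can_inj (@ordSK k.+1)).
  exact: rev_ord_inj.
apply/forallP => i; rewrite !ffunE /= inv_letterK.
have := valid_reduced (rev_ord (ordS i)) vc; rewrite ordS_rev_ordS.
by rewrite eq_sym.
Qed.

Lemma contains_edgesP pi k (c : walk k) :
  reflect (forall i, has_edge pi (edge c i)) (contains (edges c) pi).
Proof.
apply: (iffP allP) => [H i|H e /edgesP[i ->] //]; exact/H/mem_edges.
Qed.

Lemma contains_rotate pi k (c : walk k) :
  contains (edges c) pi -> contains (edges (rotate_walk c)) pi.
Proof. by move/contains_edgesP=> H; apply/contains_edgesP => i; rewrite edge_rotate.
  Qed.

Lemma contains_reverse pi k (c : walk k) :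
  contains (edges c) pi -> contains (edges (reverse_walk c)) pi.
Proof.
move/contains_edgesP=> H; apply/contains_edgesP => i.
by rewrite edge_reverse has_edge_inv.
Qed.

Lemma same_cycle_stable k (Q : walk k -> Prop) :
  (forall c, Q c -> Q (rotate_walk c)) -> (forall c, Q c -> Q (reverse_walk c)) ->
  forall c c', same_cycle c c' -> Q c -> Q c'.
Proof.
move=> Qr Qv c c' /existsP[j /orP[]/eqP -> Qc]; elim: (nat_of_ord j) => /= [|m];
  by [|exact: Qr|exact: Qv].
Qed.

Lemma same_cycle_refl k (c : walk k) : same_cycle c c.
Proof. by apply/existsP; exists ord0; rewrite eqxx. Qed.

Lemma same_cycle_sym k (c c' : walk k) : same_cycle c c' = same_cycle c' c.
Proof.
have [_ E] := @same_cycle_equivalence d n k.+1 isT c c' c.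
have [_ E'] := @same_cycle_equivalence d n k.+1 isT c' c c'.
by apply/idP/idP => [/E|/E']; rewrite same_cycle_refl => <-.
Qed.

Lemma iter_rotate k i (c : walk k) q :
  (iter i (@rotate_walk d n k.+1) c).1 q = c.1 (iter i (@ordS k.+1) q) /\
  (iter i (@rotate_walk d n k.+1) c).2 q = c.2 (iter i (@ordS k.+1) q).
Proof.
elim: i q => [//|i IH] q; rewrite iterS iterSr /= !ffunE; exact: IH.
Qed.

Lemma iter_rotate_inj k (c : walk k) : valid c ->
  forall i j : 'I_k.+1, iter i (@rotate_walk d n k.+1) c = iter j (@rotate_walk d n
    k.+1) c ->
  i = j.
Proof.
move=> vc i j E; have [Ei _] := iter_rotate i c ord0; have [Ej _] := iter_rotate j c
  ord0.
rewrite -[i]pos_ord -[j]pos_ord; apply: (valid_inj vc).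
by rewrite -Ei -Ej E.
Qed.

(** A walk that equals a rotation of its reversal would turn back on its own edge
    at some vertex. *)
Lemma rotate_neq_reverse k (c : walk k) i j : valid c ->
  iter i (@rotate_walk d n k.+1) c != iter j (@rotate_walk d n k.+1) (reverse_walk c).
Proof.
move=> vc; apply/negP => /eqP E; have inj := valid_inj vc.
pose q := iter j (@ordS k.+1) ord0.
pose p := rev_ord q.
have [E1 E2] := iter_rotate i c ord0; have [E3 E4] := iter_rotate j (reverse_walk c)
  ord0.
rewrite E E3 /= !ffunE -/q -/p in E1; rewrite E E4 /= !ffunE -/q -/p in E2.
have := valid_reduced p vc; rewrite (inj _ _ E1) -E2.
by rewrite inv_letterK eqxx.
Qed.

(** Rotations and reversal act freely on valid walks, also for lengths one and
    two; this allows to count cycles by counting walks. *)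
Lemma card_same_cycle k (c : walk k) : valid c ->
  #|[set b | same_cycle c b]| = 2 * k.+1.
Proof.
move=> vc; pose r := @rotate_walk d n k.+1.
pose f (p : bool * 'I_k.+1) := iter p.2 r (if p.1 then reverse_walk c else c).
have -> : [set b | same_cycle c b] = [set f p | p in [set: bool * 'I_k.+1]].
  apply/setP => b; rewrite inE; apply/existsP/imsetP.
    by case=> j /orP[]/eqP ->; [exists (false, j)|exists (true, j)].
  by case=> -[[] j] _ ->; exists j; rewrite eqxx ?orbT.
rewrite card_in_imset; first by rewrite cardsT card_prod card_bool card_ord.
move=> [b i] [b' i'] _ _; rewrite /f /=; case: b; case: b'.
- by move/(iter_rotate_inj (valid_reverse vc)) ->.
- by move/esym/eqP; rewrite (negbTE (rotate_neq_reverse _ _ vc)).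
- by move/eqP; rewrite (negbTE (rotate_neq_reverse _ _ vc)).
- by move/(iter_rotate_inj vc) ->.
Qed.

(** A reduced walk inside [c] cannot turn back, so once it starts along [c] it
    follows [c] forever. *)
Lemma inside_aligned j k (c : walk k) (b : walk j) : valid c -> valid b ->
  inside (edges c) b -> edge b ord0 = edge c ord0 ->
  forall i, edge b (pos j i) = edge c (pos k i).
Proof.
move=> vc vb /allP ins E0; elim=> [//|i [E1 E2 E3]].
have /orP[] := ins _ (mem_edges b (pos j i.+1)).
  move/edgesP=> [q Eq]; rewrite Eq; congr (edge c _); apply: (valid_inj vc).
  by case: Eq => <- _ _; rewrite -E3.
move/edgesP=> [q [_ Eq1 Eq2]].
have E : q = pos k i.
  by apply: (can_inj (@ordSK k.+1)); apply: (valid_inj vc); rewrite -Eq2 -E3.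
have := valid_reduced (pos j i) vb; rewrite -[ordS _]/(pos j i.+1) Eq1 E E2.
by rewrite eqxx.
Qed.

Lemma inside_align j k (c : walk k) (b : walk j) : inside (edges c) b ->
  exists2 c' : walk k, same_cycle c c' & edge b ord0 = edge c' ord0.
Proof.
move=> /allP /(_ _ (mem_edges b ord0)) /orP[]/edgesP[q Eq].
  exists (iter q (@rotate_walk d n k.+1) c).
    by apply/existsP; exists q; rewrite eqxx.
  have [E1 E2] := iter_rotate q c ord0; have [E3 _] := iter_rotate q c (ordS ord0).
  by rewrite Eq /edge E1 E2 E3 -iterSr iterS -[iter q _ _]/(pos k q) pos_ord.
pose p : 'I_k.+1 := rev_ord q.
exists (iter p (@rotate_walk d n k.+1) (reverse_walk c)).
  by apply/existsP; exists p; rewrite eqxx orbT.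
have [E1 E2] := iter_rotate p (reverse_walk c) ord0.
have [E3 _] := iter_rotate p (reverse_walk c) (ordS ord0).
rewrite -[edge b ord0]inv_edgeK Eq /edge E1 E2 E3 -iterSr iterS -[iter p _ _]/(pos k
  p) pos_ord.
by rewrite -/(edge (reverse_walk c) p) edge_reverse rev_ordK.
Qed.

Lemma same_cycle_invariants k (c c' : walk k) : same_cycle c c' ->
  [/\ valid c -> valid c', covers (edges c') =1 covers (edges c) &
      forall pi, contains (edges c) pi -> contains (edges c') pi].
Proof.
move=> S; split.
- exact: (same_cycle_stable (@valid_rotate k) (@valid_reverse k) S).
- pose Q (b : walk k) := covers (edges b) =1 covers (edges c).
  have Qr b : Q b -> Q (rotate_walk b) by move=> E e; rewrite covers_rotate E.
  have Qv b : Q b -> Q (reverse_walk b) by move=> E e; rewrite covers_reverse E.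
  exact: (same_cycle_stable Qr Qv S).
- move=> pi; exact: (same_cycle_stable (@contains_rotate pi k) (@contains_reverse pi
    k) S).
Qed.

(** The common itinerary has both lengths as periods, and neither walk repeats a
    vertex earlier. *)
Lemma inside_same_length j k (c : walk k) (b : walk j) : valid c -> valid b ->
  inside (edges c) b -> j = k.
Proof.
move=> vc vb ins; have [c' S E0] := inside_align ins.
have [vc' C' _] := same_cycle_invariants S; have {vc'} vc := vc' vc.
have {}ins : inside (edges c') b by rewrite /inside (eq_all C').
have H := inside_aligned vc vb ins E0.
have pos0 m : ordS (pos m m) = ord0.
    by apply: val_inj; rewrite -[ordS _]/(pos m m.+1) val_pos modnn.
have dv1 : k.+1 %| j.+1.
  have [E _ _] := H j.+1; have [E' _ _] := H 0.
  have {}E : c'.1 (pos k 0) = c'.1 (pos k j.+1) by rewrite -E' -E /= pos0.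
  have /(congr1 val) := valid_inj vc E.
  by rewrite !val_pos mod0n => /esym /eqP.
have dv2 : j.+1 %| k.+1.
  have [E _ _] := H k.+1; have [E' _ _] := H 0.
  have {}E : b.1 (pos j k.+1) = b.1 (pos j 0) by rewrite E E' /= pos0.
  have /(congr1 val) := valid_inj vb E.
  by rewrite !val_pos mod0n => /eqP.
by apply/eqP; rewrite -eqSS eqn_dvd dv1 dv2.
Qed.

Lemma inside_same_cycle k (c b : walk k) : valid c -> valid b ->
  inside (edges c) b = same_cycle c b.
Proof.
move=> vc vb; apply/idP/idP => [ins|S]; last first.
  have [_ C _] := same_cycle_invariants S.
  by rewrite /inside -(eq_all C); apply/allP => e; rewrite /covers => ->.
have [c' S E0] := inside_align ins; suff -> : b = c' by [].
have [vc' C' _] := same_cycle_invariants S; have {vc'} vc := vc' vc.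
have {}ins : inside (edges c') b by rewrite /inside (eq_all C').
have H i : edge b i = edge c' i by rewrite -[i]pos_ord (inside_aligned vc vb ins E0).
rewrite [b]surjective_pairing [c']surjective_pairing; congr pair; apply/ffunP => i;
  by have [] := H i.
Qed.

End CycleWalks.

(** * Prescribing the edges of a cycle one at a time *)

Section Conditioning.
Local Open Scope nat_scope.
Variables d n : nat.
Notation labelling := (labelling d n).
Notation labeled_edge := (labeled_edge d n).
Notation walk k := (closed_walk d n k.+1).
Implicit Types (pi : labelling) (k j : nat) (F : seq labeled_edge).

Lemma card_classes k (D : {set walk k}) :
  (forall b, b \in D -> valid b) ->
  (forall b b', b \in D -> same_cycle b b' -> b' \in D) ->
  #|D| = 2 * k.+1 * #|equivalence_partition (@same_cycle d n k.+1) D|.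
Proof.
move=> Dv Dc; have eqv : {in D & &, equivalence_rel (@same_cycle d n k.+1)}.
  by move=> x y z _ _ _; exact: same_cycle_equivalence.
rewrite mulnC; apply: card_uniform_partition (equivalence_partitionP eqv).
move=> A /imsetP[b bD ->]; rewrite -(card_same_cycle (Dv _ bD)).
by apply: eq_card => b'; rewrite !inE; apply/andP/idP => [[]|S] //; split=> //;
  exact: Dc S.
Qed.

(** The cycles not made of edges of [F] alone.  If [F] consists of the edges of a
    cycle [c], these are the cycles other than [c]. *)
Definition cycle_set pi F k : {set walk k} := [set b | is_cycle pi b && ~~ inside F b].

Definition cycles_off pi F k :=
  #|equivalence_partition (@same_cycle d n k.+1) (cycle_set pi F k)|.

Lemma is_cycle_same pi k (b b' : walk k) : same_cycle b b' -> is_cycle pi b ->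
  is_cycle pi b'.
Proof.
by move=> S; rewrite !is_cycleE => /andP[v C]; have [-> // _ ->] :=
  same_cycle_invariants S.
Qed.

Lemma inside_same F k (b b' : walk k) : same_cycle b b' -> inside F b -> inside F b'.
Proof.
move=> S /allP H; have [_ C _] := same_cycle_invariants S; apply/allP => e eb'.
have : covers (edges b) e by rewrite -C /covers eb'.
case/orP=> /H //; rewrite /covers inv_edgeK orbC //.
Qed.

Lemma card_cycle_set pi F k : #|cycle_set pi F k| = 2 * k.+1 * cycles_off pi F k.
Proof.
apply: card_classes => [b|b b']; rewrite !inE.
  by case/andP; rewrite is_cycleE => /andP[].
case/andP=> cb nb S; rewrite (is_cycle_same S cb) /=; apply: contra nb.
by apply: inside_same; rewrite same_cycle_sym.
Qed.

Lemma card_cycles pi k : #|[set b : walk k | is_cycle pi b]| = 2 * k.+1 * num_cycles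
  pi k.+1.
Proof.
apply: card_classes => [b|b b']; rewrite !inE; first by rewrite is_cycleE => /andP[].
by move=> + S; exact: is_cycle_same.
Qed.

Lemma card_cycles_split pi F k : #|[set b : walk k | is_cycle pi b]| =
  #|cycle_set pi F k| + #|[set b : walk k | is_cycle pi b && inside F b]|.
Proof.
rewrite -(cardsID [set b | inside F b]) addnC; congr (_ + _); apply: eq_card => b;
by rewrite !inE // andbC.
Qed.

(** When [c] is present it is the only cycle all of whose edges are in [c]. *)
Lemma num_cycles_at pi k (c : walk k) j : is_cycle pi c ->
  num_cycles pi j.+1 = cycles_off pi (edges c) j + (j == k).
Proof.
move=> cc; have vc : valid c by move: cc; rewrite is_cycleE => /andP[].
have H : #|[set b : walk j | is_cycle pi b && inside (edges c) b]| = 2 * j.+1 * (j ==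
  k).
  have [jk|jk] := eqVneq j k; last first.
    rewrite muln0; apply/eqP; rewrite cards_eq0; apply/eqP/setP => b; rewrite !inE.
    apply/negP => /andP[]; rewrite is_cycleE => /andP[vb _] /(inside_same_length vc
      vb) E.
    by rewrite E eqxx in jk.
  subst j; rewrite muln1 -(card_same_cycle vc); apply: eq_card => b; rewrite !inE.
  apply/andP/idP => [[]|S].
    by rewrite is_cycleE => /andP[vb _]; rewrite inside_same_cycle.
  have cb := is_cycle_same S cc; split=> //; rewrite inside_same_cycle //.
  by move: cb; rewrite is_cycleE => /andP[].
have := card_cycles_split pi (edges c) j.
rewrite card_cycles H card_cycle_set -mulnDr => /eqP.
by rewrite eqn_mul2l /= => /eqP.
Qed.

Lemma cycle_at_root pi F j (q : 'I_j.+1) u :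
  #|[set b : walk j | [&& is_cycle pi b, ~~ inside F b & b.1 q == u]]| <= #|rooted pi
    F u j|.
Proof.
pose r := iter q (@rotate_walk d n j.+1).
have rinj : injective r.
  apply: (can_inj (g := iter (j.+1 - q) (@rotate_walk d n j.+1))) => b.
  by rewrite /r -iterD subnK ?rotate_walk_iter // ltnW.
rewrite -(card_imset _ rinj); apply: subset_leq_card; apply/fintype.subsetP => b'
  /imsetP[b].
rewrite inE => /and3P[cb nb /eqP bu] ->.
have S : same_cycle b (r b) by apply/existsP; exists q; rewrite eqxx.
rewrite inE (is_cycle_same S cb) /=; apply/andP; split.
  by have [-> _] := iter_rotate q b ord0; rewrite -[iter _ _ _]/(pos j q) pos_ord bu.
by apply: contra nb; apply: inside_same; rewrite same_cycle_sym.
Qed.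

Lemma cycles_visiting pi F j (U : seq 'I_n) :
  #|[set b : walk j | [&& is_cycle pi b, ~~ inside F b & [exists q, b.1 q \in U]]]|
  <= j.+1 * \sum_(u <- U) #|rooted pi F u j|.
Proof.
apply: (@leq_trans (\sum_(q < j.+1) \sum_(u <- U)
   #|[set b : walk j | [&& is_cycle pi b, ~~ inside F b & b.1 q == u]]|)); last first.
  rewrite -[X in X * _](card_ord j.+1) -sum_nat_const; apply: leq_sum => q _.
  by apply: leq_sum => u _; exact: cycle_at_root.
have E (q : 'I_j.+1) u : #|[set b : walk j | [&& is_cycle pi b, ~~ inside F b & b.1 q
  == u]]| =
   \sum_(b : walk j | is_cycle pi b && ~~ inside F b) (b.1 q == u).
  by rewrite -sum1_card -big_mkcondr; apply: eq_bigl => b; rewrite inE andbA.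
under eq_bigr do (under eq_bigr do rewrite E; rewrite exchange_big).
rewrite exchange_big /= -sum1_card.
rewrite [leqRHS](bigID [pred b : walk j | [exists q, b.1 q \in U]]) /=.
apply: leq_trans (leq_addr _ _).
apply: (@leq_trans (\sum_(b : walk j |
    (is_cycle pi b && ~~ inside F b) && [exists q, b.1 q \in U]) 1)).
  by apply: eq_leq; apply: eq_bigl => b; rewrite inE andbA.
apply: leq_sum => b /andP[_ /existsP[q qU]].
rewrite (bigD1 q) //=; apply: leq_trans (leq_addr _ _).
by rewrite (big_rem _ qU) /= eqxx.
Qed.

(** A switch that redirects [s] from [y] to [t] destroys the edge leaving [s] and
    the edge arriving at [t]; every lost cycle passes through [s] or [t]. *)
Lemma cycles_lost pi F x s t j :
  #|cycle_set pi F j :\: cycle_set (switch x t (letter_perm pi x s) pi) F j|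
  <= j.+1 * \sum_(u <- [:: s; t]) #|rooted pi F u j|.
Proof.
set y := letter_perm pi x s; apply: leq_trans (cycles_visiting _ _ _ _); apply:
  subset_leq_card.
apply/fintype.subsetP => b; rewrite !inE => /andP[+ /andP[cb nb]].
rewrite nb cb /= andbT; move: (cb); rewrite !is_cycleE => /andP[vb /contains_edgesP C].
rewrite vb /= => /contains_edgesP nC.
have [i ni] : exists i, ~~ has_edge (switch x t y pi) (edge b i).
  apply/existsP; rewrite -negb_forall; apply/forallP => H; exact: nC.
have : (t \in heads x [:: edge b i]) || (y \in heads x [:: edge b i]).
  apply/negPn; rewrite negb_or; apply: contra ni => /andP[h1 h2].
  exact: switch_has_edge (C i).
have Ci := C i; rewrite /has_edge /edge /= in Ci.
rewrite !mem_heads /= !orbF => /orP[/orP[]/andP[/eqP E1 /eqP E2]|/orP[]/andP[/eqP E1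
  /eqP E2]].
- by apply/existsP; exists (ordS i); rewrite E2 !inE eqxx orbT.
- by apply/existsP; exists i; rewrite E2 !inE eqxx orbT.
- apply/existsP; exists i; rewrite !inE; apply/orP; left.
  move: Ci; rewrite E1 E2 /y => /eqP /perm_inj ->; exact: eqxx.
- apply/existsP; exists (ordS i); rewrite !inE; apply/orP; left.
  by move: Ci; rewrite E1 E2 letter_perm_inv /y => /eqP /perm_inj ->.
Qed.

(** Redirecting [s] to [t] is a bijection from the labellings that contain [F] to
    the pairs of a labelling that contains [F] and the new edge, and a free
    vertex [y], the former image of [s]. *)
Lemma switch_reindex (V : Type) (idx : V) (op : Monoid.com_law idx)
    (psi : labelling -> labelling -> V) F s x t :
  t \notin heads x F -> s \notin heads (inv_letter x) F ->
  \big[op/idx]_(pi | contains F pi) psi pi (switch x t (letter_perm pi x s) pi) =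
  \big[op/idx]_(pi | contains (rcons F (s, x, t)) pi)
     \big[op/idx]_(y | y \notin heads x F) psi (switch x t y pi) pi.
Proof.
move=> tF sF; rewrite pair_big_dep /=.
rewrite (reindex_onto (fun p : labelling * 'I_n => switch x t p.2 p.1)
   (fun pi => (switch x t (letter_perm pi x s) pi, letter_perm pi x s))) /=; last first.
  by move=> pi _; rewrite switchK.
have aux pi y : switch x t (letter_perm (switch x t y pi) x s) (switch x t y pi) = pi ->
   letter_perm (switch x t y pi) x s = y -> letter_perm pi x s = t.
  move=> _ E2; have := switch_same x t y (switch x t y pi) s.
  by rewrite switchK E2 tpermR.
have yheads pi y : contains F pi -> letter_perm pi x s = y -> y \notin heads x F.
  move=> C E; apply: contra sF; rewrite !mem_heads => /hasP[e eF He].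
  apply/hasP; exists e => //; have := allP C _ eF; rewrite /has_edge inv_letterK => Ce.
  case/orP: He => /andP[/eqP E1 /eqP E2]; apply/orP; [right|left]; rewrite E1 eqxx /=.
    by move: Ce; rewrite E1 E2 -E => /eqP /perm_inj ->.
  by move: Ce; rewrite E1 E2 letter_perm_inv -E => /eqP /perm_inj ->.
apply: congr_big => // [[pi y] /=|[pi y] /= /andP[_ /eqP[E1 E2]]]; last by rewrite E1.
have -> : contains (rcons F (s, x, t)) pi = (letter_perm pi x s == t) && contains F pi.
  by rewrite /contains all_rcons.
apply/idP/idP => [/andP[C /eqP[E1 E2]]|/andP[/andP[/eqP E C] yF]].
  have yF := yheads _ _ C E2.
  by rewrite yF (aux _ _ E1 E2) eqxx /= andbT -(contains_switch _ tF yF).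
have E2 : letter_perm (switch x t y pi) x s = y by rewrite switch_same E tpermL.
by rewrite E2 switchK eqxx andbT contains_switch.
Qed.

Lemma num_containing_rcons F s x t :
  t \notin heads x F -> s \notin heads (inv_letter x) F ->
  num_containing F = #|[pred y | y \notin heads x F]| * num_containing (rcons F (s,
    x, t)).
Proof.
move=> tF sF; have H : \sum_(pi | contains F pi) 1 =
    \sum_(pi | contains (rcons F (s, x, t)) pi) \sum_(y | y \notin heads x F) 1.
  exact: (switch_reindex addn (fun _ _ => 1) tF sF).
rewrite /num_containing !cardsE -[LHS]sum1_card H.
under eq_bigr do rewrite sum1_card.
by rewrite sum_nat_const mulnC.
Qed.

Definition force (e : labeled_edge) pi := switch e.1.2 e.2 (letter_perm pi e.1.2
  e.1.1) pi.

Lemma force_reindex (V : Type) (idx : V) (op : Monoid.com_law idx)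
    (psi : labelling -> labelling -> V) F e :
  e.2 \notin heads e.1.2 F -> e.1.1 \notin heads (inv_letter e.1.2) F ->
  \big[op/idx]_(pi | contains F pi) psi pi (force e pi) =
  \big[op/idx]_(pi | contains (rcons F e) pi)
     \big[op/idx]_(y | y \notin heads e.1.2 F) psi (switch e.1.2 e.2 y pi) pi.
Proof. by case: e => [[s x] t]; exact: switch_reindex. Qed.

Lemma switchC x v y pi : switch x v y pi = switch x y v pi.
Proof. by apply/ffunP => l; rewrite !ffunE tpermC. Qed.

Lemma take_edgesS k (c : walk k) a : a < k.+1 ->
  take a.+1 (edges c) = rcons (take a (edges c)) (edge c (pos k a)).
Proof. by move=> ak; rewrite (take_nth (edge c ord0)) ?size_edges // nth_edges. Qed.

(** Four families of cycles change when one more edge of [c] is forced: those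
    through the tail or the head of this edge before the switch, those through
    its tail after the switch, and those through the former image of the tail.
    That vertex is random, but given the labelling after the switch it is
    uniform over the free vertices, so it can be averaged over.  Each family
    contributes [4 (2d-1)^(j+1)] by [escaping_bound]. *)
Lemma stage_change k (c : walk k) a j : 2 <= d -> valid c -> a < k.+1 ->
  (\sum_(pi | contains (take a (edges c)) pi)
     (#|cycle_set pi (edges c) j :\: cycle_set (force (edge c (pos k a)) pi) (edges
       c) j| +
      #|cycle_set (force (edge c (pos k a)) pi) (edges c) j :\: cycle_set pi (edges
        c) j|))
    * (n - k - j.+2)
  <= 16 * j.+1 * (2 * d - 1) ^ j.+1 * num_containing (take a (edges c)).
Proof.
move=> d2 vc ak; set E := edges c; set B := (2 * d - 1) ^ j.+1; set M := n - k - j.+2.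
have [tF sF] := heads_take_edges vc ak.
have FE := take_edgesS c ak; rewrite -/E in tF sF FE.
set F := take a E in tF sF FE *; set e := edge c (pos k a) in tF sF FE *.
set s := e.1.1 in sF *; set x := e.1.2 in tF sF *; set t := e.2 in tF *.
have covE b : forall e', covers (take b E) e' -> covers E e'.
  by move=> e' /orP[]/mem_take H; rewrite /covers H ?orbT.
have root_bound b u : b <= k.+1 ->
   (\sum_(pi | contains (take b E) pi) #|rooted pi E u j|) * M
   <= num_containing (take b E) * (4 * B).
  move=> bk; apply: leq_trans (escaping_bound u j.+1 u d2 (@indegree_edges d n k c b
    vc)).
  apply: leq_mul; first by apply: leq_sum => pi _; apply: card_rooted; exact: covE.
  by rewrite size_take_min size_edges /M; have := geq_minl b k.+1; lia.
set m := #|[pred y | y \notin heads x F]|.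
have NF : num_containing F = m * num_containing (take a.+1 E).
  rewrite FE [e]surjective_pairing [e.1]surjective_pairing.
  exact: num_containing_rcons.
have lost pi : #|cycle_set pi E j :\: cycle_set (force e pi) E j| <=
   j.+1 * (#|rooted pi E s j| + #|rooted pi E t j|).
  by apply: leq_trans (cycles_lost _ _ _ _ _ _) _; rewrite !big_cons big_nil addn0.
have gained pi : #|cycle_set (force e pi) E j :\: cycle_set pi E j| <=
   j.+1 * (#|rooted (force e pi) E s j| + #|rooted (force e pi) E (letter_perm pi x
     s) j|).
  have := cycles_lost (force e pi) E x s (letter_perm pi x s) j.
  have -> : letter_perm (force e pi) x s = t by rewrite switch_same tpermR.
  by rewrite switchC /force switchK !big_cons big_nil addn0.
have S1 u : (\sum_(pi | contains F pi) #|rooted pi E u j|) * M <= num_containing F *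
  (4 * B).
  by apply: root_bound; exact: ltnW.
have S2 u : (\sum_(pi | contains F pi) #|rooted (force e pi) E u j|) * M <=
  num_containing F * (4 * B).
  have -> : \sum_(pi | contains F pi) #|rooted (force e pi) E u j| =
     \sum_(pi | contains (rcons F e) pi) \sum_(y | y \notin heads x F) #|rooted pi E
       u j|.
    exact: (force_reindex addn (fun _ pi => #|rooted pi E u j|) tF sF).
  under eq_bigr do rewrite sum_nat_const.
  rewrite -big_distrr /= NF -!mulnA leq_mul2l -FE; apply/orP; right.
  exact: root_bound.
have S3 : (\sum_(pi | contains F pi) #|rooted (force e pi) E (letter_perm pi x s) j|)
  * M
    <= num_containing F * (4 * B).
  have -> : \sum_(pi | contains F pi) #|rooted (force e pi) E (letter_perm pi x s) j| =
     \sum_(pi | contains (rcons F e) pi) \sum_(y | y \notin heads x F) #|rooted pi E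
       y j|.
    transitivity (\sum_(pi | contains (rcons F e) pi) \sum_(y | y \notin heads x F)
       #|rooted pi E (letter_perm (switch x t y pi) x s) j|).
      exact: (force_reindex addn (fun pi' pi => #|rooted pi E (letter_perm pi' x s)
        j|) tF sF).
    apply: eq_bigr => pi; rewrite /contains all_rcons => /andP[/eqP Ee _].
    by apply: eq_bigr => y _; rewrite switch_same Ee tpermL.
  rewrite exchange_big big_distrl /= NF.
  apply: (@leq_trans (\sum_(y | y \notin heads x F) num_containing (take a.+1 E) * (4
    * B))).
    by apply: leq_sum => y _; rewrite -FE; exact: root_bound.
  by rewrite sum_nat_const mulnA.
apply: (@leq_trans ((\sum_(pi | contains F pi) (j.+1 * (#|rooted pi E s j| + #|rooted
  pi E t j|) +
   j.+1 * (#|rooted (force e pi) E s j| + #|rooted (force e pi) E (letter_perm pi x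
     s) j|))) * M)).
  by rewrite leq_mul2r; apply/orP; right; apply: leq_sum => pi _; exact: leq_add.
rewrite big_split /= -!big_distrr /= !big_split /= -mulnDr -mulnA.
apply: (@leq_trans (j.+1 * (16 * (num_containing F * B)))); last first.
  by apply: eq_leq; ring.
rewrite leq_mul2l; apply/orP; right; rewrite !mulnDl.
apply: leq_trans (leq_add (leq_add (S1 s) (S1 t)) (leq_add (S2 s) S3)) _.
by apply: eq_leq; ring.
Qed.

(** A cycle inside [c] passes through one of its [k + 1] vertices, and each vertex
    lies on few cycles. *)
Lemma few_cycles_inside k (c : walk k) j : 2 <= d -> valid c ->
  (\sum_(pi : labelling) #|[set b : walk j | is_cycle pi b && inside (edges c) b]|) *
    (n - j.+1)
  <= 4 * k.+1 * j.+1 * (2 * d - 1) ^ j.+1 * #|labelling|.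
Proof.
move=> d2 vc; set B := (2 * d - 1) ^ j.+1.
pose U := [seq c.1 i | i <- enum 'I_k.+1].
have H pi : #|[set b : walk j | is_cycle pi b && inside (edges c) b]| <=
   j.+1 * \sum_(u <- U) #|rooted pi [::] u j|.
  apply: leq_trans (cycles_visiting _ _ _ _); apply: subset_leq_card.
  apply/fintype.subsetP => b; rewrite !inE => /andP[-> /allP ins] /=.
  have := ins _ (mem_edges b ord0); rewrite covers_edges => /existsP[i Hi].
  apply/existsP; exists ord0; case/orP: Hi => /eqP E.
    by have [-> _ _] := E; apply: map_f; rewrite mem_enum.
  by case: E => _ _ ->; apply: map_f; rewrite mem_enum.
have R u : (\sum_(pi : labelling) #|rooted pi [::] u j|) * (n - j.+1) <= #|labelling|
  * (4 * B).
  have -> : #|labelling| = num_containing ([::] : seq labeled_edge).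
    by rewrite /num_containing cardsE; apply: eq_card.
  have deg : indegree_le2 ([::] : seq labeled_edge).
    by move=> v; rewrite eq_card0 // => p; rewrite inE.
  apply: leq_trans (escaping_bound u j.+1 u d2 deg); rewrite subn0 leq_mul2r.
  by apply/orP; right; apply: leq_sum => pi _; exact: card_rooted.
apply: (@leq_trans ((\sum_(pi : labelling) j.+1 * \sum_(u <- U) #|rooted pi [::] u
  j|) * (n - j.+1))).
  by rewrite leq_mul2r; apply/orP; right; apply: leq_sum.
rewrite -big_distrr exchange_big /= -mulnA big_distrl /=.
have SU : size U = k.+1 by rewrite size_map size_enum_ord.
apply: (@leq_trans (j.+1 * (k.+1 * (#|labelling| * (4 * B))))).
  rewrite leq_mul2l; apply/orP; right; rewrite -SU.
  rewrite -sum1_size big_distrl /=; apply: leq_sum => u _; rewrite mul1n; exact: R.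
by apply: eq_leq; ring.
Qed.

(** When [a] edges have been prescribed, the next one is hit by one out of at
    least [n - a] and at most [n] free vertices. *)
Lemma num_containing_bounds k (c : walk k) : valid c ->
  n ^_ k.+1 * num_containing (edges c) <= #|labelling| <=
  n ^ k.+1 * num_containing (edges c).
Proof.
move=> vc; have N0 : #|labelling| = num_containing (take 0 (edges c)).
  by rewrite take0 /num_containing cardsE; apply: eq_card.
have H a : a <= k.+1 -> n ^_ a * num_containing (take a (edges c)) <= #|labelling| <=
   n ^ a * num_containing (take a (edges c)).
  elim: a => [_|a IH ak]; first by rewrite -N0 expn0 ffactn0 !mul1n leqnn.
  have [tF sF] := heads_take_edges vc ak.
  have := num_containing_rcons tF sF.
  rewrite -!surjective_pairing -take_edgesS //; set m := #|_| => Nm.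
  have /andP[h1 h2] := IH (ltnW ak).
  have m1 : n - a <= m.
    apply: leq_trans (card_notin _); rewrite leq_sub2l //.
    by apply: leq_trans (size_heads _ _) _; rewrite size_take_min geq_minl.
  have m2 : m <= n by rewrite -[leqRHS](card_ord n); exact: max_card.
  apply/andP; split.
    apply: leq_trans h1; rewrite ffactnSr -mulnA leq_mul2l Nm; apply/orP; right.
    by rewrite leq_mul2r m1 orbT.
  apply: (leq_trans h2); rewrite expnSr -mulnA leq_mul2l Nm; apply/orP; right.
  by rewrite leq_mul2r m2 orbT.
by have := H k.+1 (leqnn _); rewrite take_oversize // size_edges.
Qed.

Lemma card_valid k : #|[set c : walk k | valid c]| = n ^_ k.+1 * num_cyc_reduced d k.+1.
Proof.
have -> : [set c : walk k | valid c] =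
   finset.setX [set f : {ffun 'I_k.+1 -> 'I_n} | injectiveb f] [set w : word d k.+1 |
     cyc_reduced w].
  by apply/setP => -[f w]; rewrite !inE.
by rewrite cardsX card_inj_ffuns !card_ord.
Qed.

End Conditioning.

(** * The approximate Poisson identity for cycle counts *)

Section Lipschitz.
Variables (R : realType) (r : nat) (G : state r -> R) (b : 'I_r -> R).
Hypothesis G_lip : forall x j, `|G (incr j x) - G x| <= b j.

Lemma lipschitz_le (x y : state r) : (forall j, x j <= y j)%N ->
  `|G y - G x| <= \sum_j b j * (y j - x j)%N%:R.
Proof.
move: {2}(\sum_j (y j - x j))%N (erefl (\sum_j (y j - x j))%N) => m.
elim: m x => [|m IH] x Em xy.
  have -> : y = x.
    apply/ffunP => j; apply/eqP; rewrite eqn_leq xy andbT -subn_eq0.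
    by have /eqP := Em; rewrite sum_nat_eq0 => /forallP /(_ j).
  by rewrite subrr normr0 big1 // => j _; rewrite subnn mulr0.
have [j xj] : exists j, (x j < y j)%N.
  apply/existsP; rewrite -[[exists _, _]]negbK negb_exists; apply/negP => /forallP H.
  suff E0 : (\sum_j (y j - x j))%N = 0%N by rewrite E0 in Em.
  by apply: big1 => j _; apply/eqP; rewrite subn_eq0 leqNgt H.
have inc i : i != j -> incr j x i = x i by move=> /negbTE ij; rewrite ffunE ij addn0.
have incj : incr j x j = (x j).+1 by rewrite ffunE eqxx addn1.
have xy' i : (incr j x i <= y i)%N.
  by have [->|ij] := eqVneq i j; rewrite ?incj // inc.
have E (V : nmodType) (f : 'I_r -> nat -> V) : \sum_i f i (y i - incr j x i)%N =
   f j (y j - x j).-1 + \sum_(i | i != j) f i (y i - x i)%N.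
  rewrite (bigD1 j) //= incj subnS; congr (_ + _).
  by apply: eq_bigr => i ij; rewrite inc.
have Em' : (\sum_i (y i - incr j x i) = m)%N.
  have := E nat (fun _ z => z); rewrite /= => ->.
  move: Em; rewrite (bigD1 j) //= => Em; apply: succn_inj; rewrite -Em -addSn.
  by rewrite prednK ?subn_gt0.
have := IH _ Em' xy'; rewrite (E R (fun i z => b i * z%:R)) => H.
have -> : G y - G x = (G y - G (incr j x)) + (G (incr j x) - G x) by ring.
apply: le_trans (ler_normD _ _) _; apply: le_trans (lerD H (G_lip x j)) _.
have yx : (y j - x j)%N = (y j - x j).-1.+1 by rewrite prednK ?subn_gt0.
rewrite [leRHS](bigD1 j) //=; move: (_.-1) yx => p ->.
by rewrite -natr1; lra.
Qed.

Lemma lipschitz (x y : state r) :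
  `|G x - G y| <= \sum_j b j * `|(x j)%:R - (y j)%:R|.
Proof.
pose z : state r := [ffun j => minn (x j) (y j)].
have zx j : (z j <= x j)%N by rewrite ffunE geq_minl.
have zy j : (z j <= y j)%N by rewrite ffunE geq_minr.
have -> : G x - G y = (G x - G z) - (G y - G z) by ring.
apply: le_trans (ler_normB _ _) _.
apply: le_trans (lerD (lipschitz_le zx) (lipschitz_le zy)) _.
rewrite -big_split /=; apply: ler_sum => j _; rewrite -mulrDr ffunE.
have b0 : 0 <= b j by apply: le_trans (G_lip x j).
rewrite ler_wpM2l // !natrB ?geq_minl ?geq_minr //.
case: (leqP (x j) (y j)) => _; first by rewrite subrr add0r distrC ler_norm.
by rewrite subrr addr0 ler_norm.
Qed.

End Lipschitz.

(** Bernoulli's inequality for falling factorials, with denominators cleared. *)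
Lemma ffact_lower m k : (m ^ k.+1 <= m ^_ k * m + k ^ 2 * m ^ k)%N.
Proof.
elim: k => [|k IH]; first by rewrite ffactn0 expn1 mul1n leq_addr.
have [mk|mk] := leqP m k.
  by apply: leq_trans (leq_addl _ _); rewrite expnS leq_mul2r; apply/orP; right; nia.
rewrite ffactnSr.
(* multiply the induction hypothesis by [m - k], the next factor *)
have h : (m ^ k.+1 * (m - k) <= (m ^_ k * m + k ^ 2 * m ^ k) * (m - k))%N by rewrite
  leq_mul2r IH orbT.
have e : (m ^ k.+2 = m ^ k.+1 * (m - k) + k * m ^ k.+1)%N.
  by rewrite [(k * _)%N]mulnC -mulnDr subnK ?expnSr // ltnW.
rewrite e; apply: leq_trans (leq_add h (leqnn _)) _.
rewrite mulnDl mulnAC -addnA leq_add2l.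
rewrite [(m ^ k.+1)%N]expnS; move: (m ^ k)%N => X.
have h2 : (k ^ 2 * X * (m - k) <= k ^ 2 * X * m)%N by rewrite leq_mul2l leq_subr orbT.
apply: leq_trans (leq_add h2 (leqnn _)) _; nia.
Qed.

Section ApproxIdentity.
Variables (R : realType) (d n r : nat).
Hypothesis d2 : (2 <= d)%N.
Hypothesis rn : (4 * r <= n)%N.
Hypothesis n0 : (0 < n)%N.
Notation labelling := (labelling d n).
Notation labeled_edge := (labeled_edge d n).
Notation walk k := (closed_walk d n k.+1).
Implicit Types (pi : labelling) (F E : seq labeled_edge) (k : 'I_r).

Definition cycle_counts pi : state r := [ffun i : 'I_r => num_cycles pi i.+1].
Definition counts_off E pi : state r := [ffun i : 'I_r => cycles_off pi E i].

(** The conditional expectation of [h] given that the edges [F] are present. *)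
Definition avg F (h : labelling -> R) : R :=
  (\sum_(pi | contains F pi) h pi) / (num_containing F)%:R.

Local Notation growth j := ((2 * d - 1)%:R ^+ j.+1 / n%:R : R).

Variables (G : state r -> R) (b : 'I_r -> R).
Hypothesis G_lip : forall x j, `|G (incr j x) - G x| <= b j.

Let b_ge0 j : 0 <= b j.
Proof. exact: le_trans (G_lip [ffun=> 0%N] j). Qed.

Lemma num_containing_take_gt0 (k : nat) (c : walk k) a : valid c ->
  (0 < num_containing (take a (edges c)))%N.
Proof.
move=> vc; have /andP[_ h] := num_containing_bounds vc.
have : (0 < n ^ k.+1 * num_containing (edges c))%N.
  by apply: leq_trans h; apply/card_gt0P; exists [ffun=> 1%g].
rewrite muln_gt0 => /andP[_ h']; apply: leq_trans h' _; apply: subset_leq_card.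
by apply/fintype.subsetP => pi; rewrite !inE -{1}(cat_take_drop a (edges c))
  /contains all_cat => /andP[].
Qed.

Lemma avg_stage k (c : walk k) a : valid c -> (a < k.+1)%N ->
  `|avg (take a.+1 (edges c)) (G \o counts_off (edges c)) -
    avg (take a (edges c)) (G \o counts_off (edges c))|
  <= \sum_j b j * (16 * growth j).
Proof.
move=> vc ak; set E := edges c; set g := G \o counts_off E.
set e := edge c (pos k a); set F := take a E.
have [tF sF] := heads_take_edges vc ak; rewrite -/E -/F -/e in tF sF.
have N0 : 0 < (num_containing F)%:R :> R by rewrite ltr0n num_containing_take_gt0.
have N1 : 0 < (num_containing (take a.+1 E))%:R :> R by rewrite ltr0n
  num_containing_take_gt0.
have FE : take a.+1 E = rcons F e := take_edgesS c ak.
have avgE : avg (take a.+1 E) g = (\sum_(pi | contains F pi) g (force e pi)) /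
  (num_containing F)%:R.
  have := num_containing_rcons tF sF; rewrite -!surjective_pairing -FE.
  set m := #|_| => NE.
  have -> : \sum_(pi | contains F pi) g (force e pi) =
     (\sum_(pi | contains (take a.+1 E) pi) g pi) * m%:R.
    rewrite mulr_suml FE; transitivity
      (\sum_(pi | contains (rcons F e) pi) \sum_(y | y \notin heads e.1.2 F) g pi).
      exact: (force_reindex +%R (fun _ pi => g pi) tF sF).
    by apply: eq_bigr => pi _; rewrite sumr_const mulr_natr.
  rewrite /avg NE natrM; move: N0; rewrite NE natrM => mN0.
  have m0 : m%:R != 0 :> R by apply: contraTneq mN0 => ->; rewrite mul0r ltxx.
  move: (\sum_(_ | _) _) (num_containing _)%:R N1 m0 {mN0} => S N N1 m0.
  by field; rewrite m0 gt_eqF.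
rewrite avgE /avg -mulrBl -sumrB normrM [X in _ * X]gtr0_norm ?invr_gt0 //.
rewrite ler_pdivrMr //; apply: le_trans (ler_norm_sum _ _ _) _.
apply: (@le_trans _ _ (\sum_(pi | contains F pi) \sum_j b j *
   `|(counts_off E (force e pi) j)%:R - (counts_off E pi j)%:R|)).
  by apply: ler_sum => pi _; exact: lipschitz.
rewrite exchange_big /= mulr_suml; apply: ler_sum => j _.
rewrite -mulr_sumr -mulrA ler_wpM2l //.
(* this is where [4 * r <= n] enters: exposing two cycles uses up to [2 * r]
   vertices, which leaves half of them free *)
have M0 : (n <= 2 * (n - k - j.+2))%N.
  by have := ltn_ord k; have := ltn_ord j; move: rn; lia.
have := stage_change j d2 vc ak; rewrite -/E -/F -/e.
set S := (\sum_(pi | _) (_ + _))%N; set M := (n - k - j.+2)%N in M0 * => HS.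
have HS2 : \sum_(pi | contains F pi) `|(counts_off E (force e pi) j)%:R - (counts_off
  E pi j)%:R|
   * (2 * j.+1)%:R <= S%:R :> R.
  rewrite /S natr_sum; apply: ler_sum => pi _; rewrite !ffunE.
  have c1 := card_cycle_set pi E j; have c2 := card_cycle_set (force e pi) E j.
  rewrite -[X in _ * X]gtr0_norm ?ltr0n // -normrM mulrBl -!natrM.
  rewrite ![(cycles_off _ _ _ * _)%N]mulnC -c1 -c2.
  have i1 := cardsID (cycle_set pi E j) (cycle_set (force e pi) E j).
  have i2 := cardsID (cycle_set (force e pi) E j) (cycle_set pi E j).
  rewrite -i1 -i2 finset.setIC !natrD ler_norml; apply/andP.
  set x := #|_ :\: _|%:R; set y := #|_ :\: _|%:R; set z := #|_ :&: _|%:R.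
  have x0 : 0 <= x :> R by rewrite ler0n.
  have y0 : 0 <= y :> R by rewrite ler0n.
  by split; lra.
rewrite -mulr_suml in HS2; set T := \sum_(pi | _) _ in HS2 *.
have j0 : 0 < (j.+1)%:R :> R by rewrite ltr0n.
have n0' : 0 < n%:R :> R by rewrite ltr0n.
have M0' : n%:R <= 2 * M%:R :> R by rewrite -natrM ler_nat.
have T0 : 0 <= T by apply: sumr_ge0.
move: HS; rewrite -(ler_nat R) !natrM natrX => HS.
rewrite mulrA -mulrA mulrAC mulrA ler_pdivlMr //.
have h1 : T * n%:R * (2 * j.+1)%:R <= 2 * (S%:R * M%:R).
  have := ler_pM (mulr_ge0 T0 (ler0n _ (2 * j.+1))) (ltW n0') HS2 M0'; lra.
have h2 := le_trans h1 (ler_wpM2l (ler0n R 2) HS).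
rewrite -(ler_pM2r (_ : 0 < (2 * j.+1)%:R)) ?ltr0n //.
apply: le_trans h2 _; by rewrite natrM le_eqVlt; apply/orP; left; apply/eqP; ring.
Qed.

Lemma avg_conditioned k (c : walk k) : valid c ->
  `|avg (edges c) (G \o counts_off (edges c)) - avg [::] (G \o counts_off (edges c))|
  <= k.+1%:R * \sum_j b j * (16 * growth j).
Proof.
move=> vc; set g := G \o _.
have H a : (a <= k.+1)%N -> `|avg (take a (edges c)) g - avg [::] g| <=
    a%:R * \sum_j b j * (16 * growth j).
  elim: a => [_|a IH ak]; first by rewrite take0 subrr normr0 mul0r.
  rewrite -(subrKA (avg (take a (edges c)) g)); apply: le_trans (ler_normD _ _) _.
  by rewrite -natr1 mulrDl mul1r addrC lerD ?IH ?avg_stage // ltnW.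
by have := H k.+1 (leqnn _); rewrite take_oversize // size_edges.
Qed.

Lemma avg_nil (h : labelling -> R) : avg [::] h = (\sum_pi h pi) / #|labelling|%:R.
Proof. by rewrite /avg /num_containing cardsE; congr (_ / _%:R); apply: eq_card. Qed.

Let labelling_gt0 : 0 < #|labelling|%:R :> R.
Proof. by rewrite ltr0n; apply/card_gt0P; exists [ffun=> 1%g]. Qed.

(** Leaving [c] out of the counts is harmless when nothing is prescribed. *)
Lemma avg_unconditioned k (c : walk k) : valid c ->
  `|avg [::] (G \o counts_off (edges c)) - avg [::] (G \o cycle_counts)|
  <= k.+1%:R * \sum_j b j * (4 * growth j).
Proof.
move=> vc; rewrite !avg_nil -mulrBl -sumrB normrM [X in _ * X]gtr0_norm ?invr_gt0 //.
rewrite ler_pdivrMr //; apply: le_trans (ler_norm_sum _ _ _) _.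
apply: (@le_trans _ _ (\sum_pi \sum_j b j *
   `|(counts_off (edges c) pi j)%:R - (cycle_counts pi j)%:R|)).
  by apply: ler_sum => pi _; exact: lipschitz.
rewrite exchange_big /= mulr_sumr mulr_suml; apply: ler_sum => j _.
rewrite -mulr_sumr mulrCA -mulrA ler_wpM2l //.
have M0 : (n <= 2 * (n - j.+1))%N by have := ltn_ord j; move: rn; lia.
have := few_cycles_inside j d2 vc.
set S := (\sum_pi _)%N; set M := (n - j.+1)%N in M0 * => HS.
have HS2 : \sum_pi `|(counts_off (edges c) pi j)%:R - (cycle_counts pi j)%:R|
   * (2 * j.+1)%:R = S%:R :> R.
  rewrite /S natr_sum; apply: eq_bigr => pi _; rewrite !ffunE.
  have := card_cycles_split pi (edges c) j; rewrite card_cycles card_cycle_set.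
  set I := #|_| => H.
  have le : (cycles_off pi (edges c) j <= num_cycles pi j.+1)%N.
    by rewrite -(leq_pmul2l (_ : 0 < 2 * j.+1)%N) // H leq_addr.
  rewrite distrC ger0_norm ?subr_ge0 ?ler_nat // mulrBl -!natrM.
  by rewrite ![(_ * (2 * j.+1))%N]mulnC H natrD addrC addKr.
rewrite -mulr_suml in HS2; set T := \sum_pi _ in HS2 *.
have j0 : 0 < (j.+1)%:R :> R by rewrite ltr0n.
have n0' : 0 < n%:R :> R by rewrite ltr0n.
have M0' : n%:R <= 2 * M%:R :> R by rewrite -natrM ler_nat.
have T0 : 0 <= T by apply: sumr_ge0.
move: HS; rewrite -(ler_nat R) !natrM natrX => HS.
rewrite mulrA mulrA [leRHS](_ : _ = (k.+1%:R * 4 * (2 * d - 1)%:R ^+ j.+1 *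
  #|labelling|%:R) / n%:R);
  last by ring.
rewrite ler_pdivlMr // -(ler_pM2r (_ : 0 < (2 * j.+1)%:R)) ?ltr0n //.
have h1 : T * n%:R * (2 * j.+1)%:R <= 2 * (S%:R * M%:R).
  by rewrite mulrAC HS2 mulrCA; rewrite ler_wpM2l.
apply: le_trans h1 _; apply: le_trans (ler_wpM2l (ler0n R 2) HS) _.
by rewrite natrM le_eqVlt; apply/orP; left; apply/eqP; ring.
Qed.

Definition rate k : R := (num_cyc_reduced d k.+1)%:R / (2 * k.+1)%:R.

(** The expected number of cycles of length [k + 1] is nearly [rate k].  A valid
    walk is present with probability between [n ^- k.+1] and the inverse of the
    falling factorial, and the number of valid walks is this falling factorial
    times the number of cyclically reduced words. *)
Lemma sum_probabilities k :
  rate k * (1 - k.+1%:R ^+ 2 / n%:R) <=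
  (2 * k.+1)%:R^-1 * \sum_(c : walk k | valid c) (num_containing (edges c))%:R /
    #|labelling|%:R
  <= rate k.
Proof.
have n0' : 0 < n%:R :> R by rewrite ltr0n.
have k0 : 0 < (2 * k.+1)%:R :> R by rewrite ltr0n.
rewrite -mulr_suml -natr_sum; set S := (\sum_(c | _) _)%N.
have N0 := labelling_gt0; set N := #|labelling| in N0 *; set A := num_cyc_reduced d
  k.+1.
have cardv : #|[pred c : walk k | valid c]| = (n ^_ k.+1 * A)%N.
  by rewrite -card_valid cardsE.
have low : (n ^_ k.+1 * S <= n ^_ k.+1 * A * N)%N.
  rewrite /S big_distrr /= -cardv -sum_nat_const; apply: leq_sum => c vc.
  by have /andP[] := num_containing_bounds vc.
have up : (n ^_ k.+1 * A * N <= n ^ k.+1 * S)%N.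
  rewrite /S big_distrr /= -cardv -sum_nat_const; apply: leq_sum => c vc.
  by have /andP[] := num_containing_bounds vc.
have f0 : (0 < n ^_ k.+1)%N by rewrite ffact_gt0; have := ltn_ord k; move: rn; lia.
have S1 : (S <= A * N)%N by move: low; rewrite -mulnA leq_mul2l -leqn0 leqNgt f0.
have S1' : S%:R / N%:R <= A%:R :> R by rewrite ler_pdivrMr // -natrM ler_nat.
have X0 : 0 < (n ^ k.+1)%:R :> R by rewrite ltr0n expn_gt0 n0.
have S2 : A%:R * (1 - k.+1%:R ^+ 2 / n%:R) <= S%:R / N%:R :> R.
  rewrite ler_pdivlMr // -(ler_pM2l X0) -natrM; apply: le_trans (_ : (n ^_ k.+1 * A *
    N)%:R <= _);
    last by rewrite ler_nat.
  rewrite 2!natrM; have h : (n ^ k.+1)%:R * n%:R <=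
      (n ^_ k.+1)%:R * n%:R + k.+1%:R ^+ 2 * (n ^ k.+1)%:R :> R.
    by rewrite -natrX -!natrM -natrD ler_nat -expnSr; exact: ffact_lower.
  move: (n ^ k.+1)%:R (n ^_ k.+1)%:R X0 h => X f X0 h.
  have -> : X * (A%:R * (1 - k.+1%:R ^+ 2 / n%:R) * N%:R) =
     (X * (1 - k.+1%:R ^+ 2 / n%:R)) * (A%:R * N%:R) by ring.
  rewrite -[leRHS]mulrA ler_wpM2r ?mulr_ge0 // -(ler_pM2r n0').
  have -> : X * (1 - k.+1%:R ^+ 2 / n%:R) * n%:R = X * n%:R - k.+1%:R ^+ 2 * X.
    by field; rewrite gt_eqF.
  lra.
have -> : rate k = (2 * k.+1)%:R^-1 * A%:R by rewrite /rate mulrC.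
by rewrite -mulrA !ler_pM2l ?invr_gt0 // S2.
Qed.

(** Splitting [C_k] into the contributions of single walks [c] turns
    [E (C_k G(C - e_k))] into a combination of the conditional means [Ac c], with
    weights that add up to nearly [rate k].  Each of them is within [D] of the
    unconditional mean [A0]. *)
Lemma cycle_counts_approx_identity k : (forall x, `|G x| <= 2) ->
  `| #|labelling|%:R^-1 * \sum_pi ((cycle_counts pi k)%:R * G (decr k (cycle_counts pi))
      - rate k * G (cycle_counts pi)) |
  <= 2 * (rate k * (k.+1%:R ^+ 2 / n%:R)) +
     \sum_(j < r) (rate k * k.+1%:R * (20 * growth j)) * b j.
Proof.
move=> G2; set N := #|labelling|%:R; set A0 := avg [::] (G \o cycle_counts).
have k0 : 0 < (2 * k.+1)%:R :> R by rewrite ltr0n.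
pose p (c : walk k) : R := (num_containing (edges c))%:R / N.
pose Ac (c : walk k) := avg (edges c) (G \o counts_off (edges c)).
have e1 : N^-1 * \sum_pi (cycle_counts pi k)%:R * G (decr k (cycle_counts pi)) =
   (2 * k.+1)%:R^-1 * \sum_(c | valid c) p c * Ac c.
  transitivity (N^-1 * \sum_(pi : labelling) (2 * k.+1)%:R^-1 * \sum_(c : walk k |
    is_cycle pi c) G (counts_off (edges c) pi)).
    congr (_ * _); apply: eq_bigr => pi _.
    have -> : \sum_(c : walk k | is_cycle pi c) G (counts_off (edges c) pi) =
       \sum_(c in [set c : walk k | is_cycle pi c]) G (decr k (cycle_counts pi)).
      apply: eq_big => [c|c cc]; first by rewrite inE.
      congr G; apply/ffunP => j; rewrite !ffunE (num_cycles_at j cc).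
      by rewrite addnK.
    rewrite sumr_const card_cycles -[X in _ = _ * X]mulr_natl.
    rewrite [(_ * num_cycles _ _)%:R]natrM -mulrA mulKf ?gt_eqF //.
    by rewrite {1}ffunE.
  rewrite -mulr_sumr mulrCA; congr (_ * _).
  rewrite (exchange_big_dep (@valid d n k)) /=; last first.
    by move=> pi c _; rewrite is_cycleE => /andP[].
  rewrite mulr_sumr; apply: eq_bigr => c vc; rewrite /p /Ac /avg.
  have NE : (num_containing (edges c))%:R != 0 :> R.
    rewrite pnatr_eq0 -lt0n -[edges c](take_size); exact: num_containing_take_gt0.
  rewrite (eq_bigl (contains (edges c))); last by move=> pi; rewrite is_cycleE vc.
  rewrite /=; move: (\sum_(_ | _) _) (num_containing _)%:R NE => S m m0.
  by field; rewrite m0 gt_eqF.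
have e2 : N^-1 * \sum_pi rate k * G (cycle_counts pi) = rate k * A0.
  by rewrite -mulr_sumr mulrCA /A0 avg_nil [N^-1 * _]mulrC.
rewrite sumrB mulrBr e1 e2.
have P := sum_probabilities k; rewrite -/N -/(p _) in P.
set Pk := (2 * k.+1)%:R^-1 * \sum_(c | valid c) p c.
have /andP[P1 P2] : rate k * (1 - k.+1%:R ^+ 2 / n%:R) <= Pk <= rate k by exact: P.
have -> : (2 * k.+1)%:R^-1 * (\sum_(c | valid c) p c * Ac c) - rate k * A0 =
   (2 * k.+1)%:R^-1 * (\sum_(c | valid c) p c * (Ac c - A0)) + (Pk - rate k) * A0.
  rewrite [in RHS](eq_bigr (fun c => p c * Ac c - p c * A0)); last by move=> c _;
    rewrite mulrBr.
  by rewrite sumrB -mulr_suml /Pk; ring.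
have A02 : `|A0| <= 2.
  rewrite /A0 avg_nil normrM [X in _ * X]gtr0_norm ?invr_gt0 // ler_pdivrMr //.
  apply: le_trans (ler_norm_sum _ _ _) _.
  apply: (@le_trans _ _ (\sum_(pi : labelling) 2)); first by apply: ler_sum => pi _;
    exact: G2.
  by rewrite sumr_const mulr_natr.
set D := k.+1%:R * \sum_j b j * (20 * growth j).
have AcD c : valid c -> `|Ac c - A0| <= D.
  move=> vc; rewrite -(subrKA (avg [::] (G \o counts_off (edges c)))).
  apply: le_trans (ler_normD _ _) _.
  apply: le_trans (lerD (avg_conditioned vc) (avg_unconditioned vc)) _.
  rewrite -mulrDr -big_split /= /D le_eqVlt; apply/orP; left; apply/eqP; congr (_ * _).
  by apply: eq_bigr => j _; ring.
have p0 c : 0 <= p c by rewrite /p divr_ge0.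
apply: le_trans (ler_normD _ _) _; rewrite addrC; apply: lerD.
  have Ple : `|Pk - rate k| <= rate k * (k.+1%:R ^+ 2 / n%:R).
    rewrite distrC ger0_norm ?subr_ge0 //; lra.
  by rewrite normrM mulrC ler_pM.
rewrite normrM gtr0_norm ?invr_gt0 //.
apply: (@le_trans _ _ (Pk * D)).
  rewrite /Pk -mulrA ler_pM2l ?invr_gt0 // mulr_suml.
  apply: le_trans (ler_norm_sum _ _ _) _; apply: ler_sum => c vc.
  by rewrite normrM ger0_norm // ler_wpM2l // AcD.
have D0 : 0 <= D.
  rewrite mulr_ge0 // sumr_ge0 // => j _; rewrite !mulr_ge0 // ?invr_ge0 ?exprn_ge0 //.
apply: le_trans (ler_wpM2r D0 P2) _.
rewrite /D mulrA mulr_sumr le_eqVlt; apply/orP; left; apply/eqP.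
by apply: eq_bigr => j _; ring.
Qed.

End ApproxIdentity.

(** * Cyclically reduced words and the size of the error *)

Section CyclicWords.
Local Open Scope nat_scope.
Variable d : nat.
Implicit Types (k : nat).

Definition word_letters k (w : word d k.+1) := [seq w (pos k i) | i <- iota 0 k.+1].

(** Reducedness across the end of the word, where a cyclic word closes up. *)
Definition wraps (s : seq (letter d)) :=
  if s is x :: s' then last x s' != inv_letter x else true.

Lemma cyc_reduced_letters k (w : word d k.+1) :
  cyc_reduced w = reduced (word_letters w) && wraps (word_letters w).
Proof.
have swap (x z : letter d) : (x != inv_letter z) = (z != inv_letter x).
  by congr (~~ _); apply/eqP/eqP => ->; rewrite inv_letterK.
have Ew : wraps (word_letters w) = (w (pos k k) != inv_letter (w (pos k 0))).
  have L (f : nat -> letter d) m j : last (f m) [seq f i | i <- iota m.+1 j] = f (m +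
    j).
    by elim: j m => [|j IH] m /=; rewrite ?addn0 // IH addSnnS.
  by have := L (fun i => w (pos k i)) 0 k; rewrite add0n /= => <-.
have wrap0 : ordS (pos k k) = pos k 0.
  by apply: val_inj; rewrite -[ordS _]/(pos k k.+1) !val_pos modnn mod0n.
rewrite Ew; apply/forallP/andP => [H|[/(sortedP (w ord0)) H Hk] i].
  split; last by have := H (pos k k); rewrite wrap0.
  apply/(sortedP (w ord0)) => i; rewrite size_map size_iota => ik.
  rewrite !(nth_map 0) ?size_iota ?nth_iota // ?(ltnW ik) //.
  by rewrite -swap; exact: H.
have [ik|ik] := ltnP i.+1 k.+1.
  have := H i; rewrite size_map size_iota => /(_ ik).
  rewrite !(nth_map 0) ?size_iota ?nth_iota // ?(ltnW ik) // !add0n -swap.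
  by rewrite -[pos k i.+1]/(ordS (pos k i)) pos_ord.
have -> : i = pos k k by rewrite -[i]pos_ord; congr (pos k _); have := ltn_ord i; lia.
by rewrite wrap0.
Qed.

Lemma sum_words k (f : seq (letter d) -> nat) :
  \sum_(w : word d k.+1) f (word_letters w) = \sum_(s <- words d k.+1) f s.
Proof.
rewrite -big_enum -(big_map (@word_letters k) xpredT f); apply: perm_big.
have inj : injective (@word_letters k).
  move=> w w' E; apply/ffunP => i; have := congr1 (fun s => nth (w i) s i) E.
  by rewrite /= !(nth_map 0) ?size_iota ?nth_iota // add0n pos_ord.
apply: uniq_perm; first by rewrite map_inj_uniq ?enum_uniq.
  exact: uniq_words.
move=> s; apply/mapP/idP => [[w _ ->]|ss].
  by rewrite -[X in words d X](size_iota 0 k.+1) -(size_map (fun i => w (pos k i)))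
    mem_words.
have x0 : letter d by case: s ss => // /size_words.
exists [ffun i : 'I_k.+1 => nth x0 s i]; first by rewrite mem_enum.
have sz := size_words ss.
apply: (@eq_from_nth _ x0); first by rewrite size_map size_iota.
move=> i; rewrite sz => ik; rewrite (nth_map 0) ?size_iota // nth_iota // ffunE.
by rewrite -[nat_of_ord _]/(val (pos k i)) val_pos modn_small.
Qed.

Lemma num_cyc_reducedE k :
  num_cyc_reduced d k.+1 = \sum_(s <- words d k.+1) (reduced s && wraps s).
Proof.
rewrite -sum_words /num_cyc_reduced -sum1_card big_mkcond /=; apply: eq_bigr => w _.
by rewrite inE cyc_reduced_letters; case: (_ && _).
Qed.

Lemma num_cyc_reduced_le k : num_cyc_reduced d k.+1 <= 2 * d * (2 * d - 1) ^ k.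
Proof.
by rewrite num_cyc_reducedE -num_reduced; apply: leq_sum => s _; case: (reduced s);
  rewrite ?leq_b1.
Qed.

(** A reduced word becomes cyclically reduced by appending any letter but two. *)
Lemma num_cyc_reduced_ge k : 2 <= d ->
  (2 * d - 1) ^ k.+1 <= 2 * num_cyc_reduced d k.+1.
Proof.
move=> d2; rewrite num_cyc_reducedE; case: k => [|k].
  rewrite expn1 big_words big_seq1 /=.
  rewrite (eq_bigr (fun=> 1)); last by move=> x _; rewrite eq_sym inv_letter_neq.
  by rewrite sum1_card card_prod card_ord card_bool; lia.
apply: (@leq_trans (2 * (2 * d * (2 * d - 1) ^ k * (2 * d - 2)))).
  rewrite !expnS; set X := _ ^ k.
  have -> : 2 * (2 * d * X * (2 * d - 2)) = (2 * (2 * d) * (2 * d - 2)) * X by ring.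
  by rewrite mulnA leq_mul2r; apply/orP; right; nia.
rewrite leq_pmul2l // -num_reduced [leqRHS]big_words big_distrl big_seq [leqRHS]big_seq.
apply: leq_sum => -[/size_words //|x s] _.
have E z : reduced (rcons (x :: s) z) = reduced (x :: s) && (z != inv_letter (last x
  s)).
  by rewrite /reduced /= rcons_path.
rewrite -[leqLHS]/(reduced (x :: s) * (2 * d - 2)).
under eq_bigr do rewrite E -andbA [wraps _]/= last_rcons.
case: (reduced _); last by rewrite mul0n.
rewrite mul1n /= -(leq_add2r (\sum_(z : letter d) (z == inv_letter x : nat)))
  -big_split /=.
apply: (@leq_trans (\sum_(z : letter d) (z != inv_letter (last x s) : nat))).
  rewrite card_neq_letter (bigD1 (inv_letter x)) //= eqxx big1.
    by lia.
  by move=> z /negbTE ->.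
by apply: leq_sum => z _; case: (_ == _); case: (_ == _).
Qed.

End CyclicWords.

Section RateBounds.
Variables (R : realType) (d : nat).
Hypothesis d2 : (2 <= d)%N.

Local Notation b := ((2 * d - 1)%:R : R).

Lemma base_ge3 : 3 <= b.
Proof. by rewrite (ler_nat R 3); lia. Qed.

Lemma ln_base_ge : 1 / 2 <= ln b.
Proof.
have b3 := base_ge3; have b0 : 0 < b by lra.
have H : ln (1 + (b^-1 - 1)) <= b^-1 - 1.
  apply: le_ln1Dx; have : 0 < b^-1 by rewrite invr_gt0.
  lra.
rewrite addrC subrK lnV // in H.
have : b^-1 <= 3^-1 by rewrite lef_pV2 ?posrE.
lra.
Qed.

(** The hypothesis on [c] says that [c * s ^+ m] grows by at least the next term. *)
Lemma sum_geometric (s c : R) m : 0 <= s -> 0 <= c -> c + s <= c * s ->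
  \sum_(k < m) s ^+ k.+1 <= c * s ^+ m.
Proof.
move=> s0 c0 cs; elim: m => [|m IH]; first by rewrite big_ord0 expr0 mulr1.
rewrite big_ord_recr /=; apply: le_trans (lerD IH (lexx _)) _.
rewrite exprS mulrA -mulrDl ler_wpM2r ?exprn_ge0 //.
Qed.

Variable r : nat.

Lemma rate_le (k : 'I_r) : rate R d k * k.+1%:R <= b ^+ k.+1.
Proof.
rewrite /rate natrM invfM mulrA mulfVK ?pnatr_eq0 // ler_pdivrMr // -natrX -natrM
  ler_nat.
apply: leq_trans (num_cyc_reduced_le _ _) _; rewrite expnSr.
by move: (_ ^ k)%N => X; nia.
Qed.

Lemma rate_ge (k : 'I_r) : b ^+ k.+1 <= 4 * r%:R * rate R d k.
Proof.
rewrite /rate mulrA ler_pdivlMr ?ltr0n // -natrX -!natrM ler_nat.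
have := num_cyc_reduced_ge k d2; have := ltn_ord k.
move: (_ ^ _)%N (num_cyc_reduced _ _) => X A kr XA; nia.
Qed.

Lemma rate_gt0 (k : 'I_r) : 0 < rate R d k.
Proof.
have : 0 < 4 * r%:R * rate R d k.
  by apply: lt_le_trans (rate_ge k); rewrite exprn_gt0 // (lt_le_trans _ base_ge3).
by rewrite pmulr_rgt0 // mulr_gt0 // ltr0n; case: r k => [[]|].
Qed.

(** Substituting [b^k / (4 r) <= rate <= b^k / k] makes every summand a multiple of
    [s^k * s^j] with [s = sqrt b], and the double sum is the square of a geometric
    sum dominated by its last term. *)
Lemma error_sum_bound n : (0 < n)%N -> (0 < r)%N ->
  \sum_(k < r) (2 * (rate R d k * (k.+1%:R ^+ 2 / n%:R)) +
    \sum_(j < r) (rate R d k * k.+1%:R * (20 * (b ^+ j.+1 / n%:R))) *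
      (6 / Num.sqrt (rate R d k * rate R d j) * ln (1 + Num.sqrt (rate R d k * rate R
        d j))))
  <= 9000 * r%:R ^+ 2 * b ^+ r * ln b / n%:R.
Proof.
move=> n0 r0; have b3 := base_ge3; have b0 : 0 < b by lra.
have n0' : 0 < n%:R :> R by rewrite ltr0n.
have r1 : 1 <= r%:R :> R by rewrite ler1n.
have rgt : 0 < r%:R :> R by rewrite ltr0n.
have lb := ln_base_ge; set l := ln b in lb *.
set s := Num.sqrt b; have s2 : s ^+ 2 = b by rewrite sqr_sqrtr // ltW.
have s0 : 0 <= s by rewrite sqrtr_ge0.
have s32 : 3 / 2 <= s.
  by rewrite leNgt; apply/negP => h; have := s2; rewrite expr2; nra.
have br1 : 1 <= b ^+ r by rewrite exprn_ege1 //; lra.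
pose V := r%:R ^+ 2 * b ^+ r * l / n%:R.
have l0 : 0 <= l by lra.
pose cc : R := 960 * r%:R ^+ 2 * l / n%:R.
have cc0 : 0 <= cc.
  exact: (divr_ge0 (mulr_ge0 (mulr_ge0 (ler0n R 960) (sqr_ge0 _)) l0) (ltW n0')).
have first : \sum_(k < r) 2 * (rate R d k * (k.+1%:R ^+ 2 / n%:R)) <= 8 * V.
  apply: (@le_trans _ _ (\sum_(k < r) (2 * r%:R / n%:R) * b ^+ k.+1)).
    apply: ler_sum => k _.
    have h1 := rate_le k; have h2 : k.+1%:R <= r%:R :> R by rewrite ler_nat.
    have h3 : rate R d k * k.+1%:R * k.+1%:R <= b ^+ k.+1 * r%:R.
      by rewrite ler_pM // mulr_ge0 ?(ltW (rate_gt0 k)).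
    have -> : 2 * (rate R d k * (k.+1%:R ^+ 2 / n%:R)) =
      (rate R d k * k.+1%:R * k.+1%:R) * (2 / n%:R) by ring.
    have -> : 2 * r%:R / n%:R * b ^+ k.+1 = (b ^+ k.+1 * r%:R) * (2 / n%:R) by ring.
    by rewrite ler_wpM2r // divr_ge0 // ltW.
  rewrite -mulr_sumr.
  have g := @sum_geometric b 2 r (ltW b0) (ler0n R 2) (_ : 2 + b <= 2 * b).
  apply: (@le_trans _ _ (2 * r%:R / n%:R * (2 * b ^+ r))).
    by rewrite ler_wpM2l ?g ?divr_ge0 ?mulr_ge0 ?ltW //; lra.
  have -> : 2 * r%:R / n%:R * (2 * b ^+ r) = (4 * b ^+ r / n%:R) * r%:R by ring.
  have -> : 8 * V = (4 * b ^+ r / n%:R) * (2 * l * r%:R ^+ 2) by rewrite /V; ring.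
  have rr : r%:R <= 2 * l * r%:R ^+ 2.
    apply: (@le_trans _ _ (r%:R ^+ 2)); first by rewrite expr2 ler_peMr.
    by rewrite ler_peMl ?exprn_ge0 //; lra.
  by rewrite ler_wpM2l // divr_ge0 ?mulr_ge0 ?exprn_ge0 // ltW.
have second (k j : 'I_r) : (rate R d k * k.+1%:R * (20 * (b ^+ j.+1 / n%:R))) *
      (6 / Num.sqrt (rate R d k * rate R d j) * ln (1 + Num.sqrt (rate R d k * rate R
        d j)))
   <= (960 * r%:R ^+ 2 * l / n%:R) * (s ^+ k.+1 * s ^+ j.+1).
  have Rk := rate_gt0 k; have Rj := rate_gt0 j.
  set L := Num.sqrt _; have L0 : 0 < L by rewrite sqrtr_gt0 mulr_gt0.
  set T := s ^+ k.+1 * s ^+ j.+1.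
  have T0 : 0 < T by rewrite mulr_gt0 ?exprn_gt0 //; lra.
  have T2 : T ^+ 2 = b ^+ k.+1 * b ^+ j.+1 by rewrite exprMn -!exprM ![(_ *
    2)%N]mulnC !exprM s2.
  have L2 : L ^+ 2 = rate R d k * rate R d j by rewrite sqr_sqrtr // mulr_ge0 ?ltW.
  have TL : T <= 4 * r%:R * L.
    rewrite -(ler_pXn2r (_ : (0 < 2)%N)) ?nnegrE ?(ltW T0) ?mulr_ge0 ?(ltW L0) //.
    rewrite T2 exprMn L2.
    have -> : (4 * r%:R) ^+ 2 * (rate R d k * rate R d j) =
      (4 * r%:R * rate R d k) * (4 * r%:R * rate R d j) by ring.
    by rewrite ler_pM ?exprn_ge0 ?rate_ge // ltW.
  have rate_br (i : 'I_r) : rate R d i <= b ^+ r.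
    apply: (@le_trans _ _ (b ^+ i.+1)); last by rewrite ler_weXn2l //; lra.
    apply: le_trans (rate_le i); rewrite ler_peMr ?ler1n // ltW //; exact: rate_gt0.
  have Lbr : L <= b ^+ r.
    rewrite -(ler_pXn2r (_ : (0 < 2)%N)) ?nnegrE ?(ltW L0) ?exprn_ge0 ?(ltW b0) //.
    by rewrite L2 expr2 ler_pM ?rate_br ?ltW.
  have br3 : 3 <= b ^+ r.
    apply: (le_trans b3); rewrite -[leLHS]expr1 ler_weXn2l //; lra.
  have lnL : ln (1 + L) <= 2 * r%:R * l.
    have -> : 2 * r%:R * l = ln ((b ^+ r) ^+ 2) by rewrite -exprM lnXn //
      -[RHS]mulr_natl natrM [r%:R * _]mulrC.
    rewrite ler_ln ?posrE ?exprn_gt0 ?addr_gt0 //; nra.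
  have h1 : rate R d k * k.+1%:R * (20 * (b ^+ j.+1 / n%:R)) <= 20 * T ^+ 2 / n%:R.
    have -> : 20 * T ^+ 2 / n%:R = b ^+ k.+1 * (20 * (b ^+ j.+1 / n%:R)) by rewrite
      T2; ring.
    by rewrite ler_wpM2r ?rate_le // mulr_ge0 ?divr_ge0 ?exprn_ge0 ?ltW.
  have h2 : 6 / L <= 24 * r%:R / T.
    rewrite ler_pdivlMr // mulrAC ler_pdivrMr //; lra.
  have lnL0 : 0 <= ln (1 + L) by rewrite ln_ge0 // lerDl ltW.
  apply: (@le_trans _ _ ((20 * T ^+ 2 / n%:R) * (24 * r%:R / T * (2 * r%:R * l)))).
    apply: ler_pM => //.
    - by rewrite mulr_ge0 // mulr_ge0 ?divr_ge0 ?exprn_ge0 // ltW.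
    - by rewrite mulr_ge0 // divr_ge0 // ltW.
    - by apply: ler_pM => //; rewrite divr_ge0 // ltW.
  rewrite le_eqVlt; apply/orP; left; apply/eqP; field.
  by rewrite !gt_eqF.
rewrite big_split /=; apply: (@le_trans _ _ (8 * V + 8640 * V)); last first.
  have V0 : 0 <= V by rewrite /V divr_ge0 ?mulr_ge0 ?exprn_ge0 ?ltW //; lra.
  have -> : 9000 * r%:R ^+ 2 * b ^+ r * l / n%:R = 9000 * V by rewrite /V; ring.
  lra.
apply: (lerD first).
apply: (@le_trans _ _ (\sum_(k < r) \sum_(j < r) (960 * r%:R ^+ 2 * l / n%:R) * (s ^+
  k.+1 * s ^+ j.+1))).
  by apply: ler_sum => k _; apply: ler_sum => j _; exact: second.
under eq_bigr do rewrite -mulr_sumr -mulr_sumr.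
rewrite -mulr_sumr -mulr_suml; set W := \sum_(k < r) _.
have W3 : W <= 3 * s ^+ r by apply: sum_geometric => //; lra.
have W0 : 0 <= W by apply: sumr_ge0 => k _; rewrite exprn_ge0.
have WW : W * W <= 9 * b ^+ r.
  have -> : 9 * b ^+ r = (3 * s ^+ r) * (3 * s ^+ r) by rewrite -s2 -exprM mulnC
    exprM; ring.
  exact: ler_pM.
rewrite -/cc; apply: le_trans (ler_wpM2l cc0 WW) _.
by rewrite /cc /V le_eqVlt; apply/orP; left; apply/eqP; ring.
Qed.

End RateBounds.

(** * Laws of the count vectors and total variation *)

Local Open Scope classical_set_scope.
Local Open Scope ring_scope.

Section FiniteUnions.
Variables (dT : measure_display) (T : measurableType dT) (R : realType).
Variable P : probability T R.

Lemma probability_disjoint_union (I : choiceType) (s : seq I) (F : I -> set T) :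
  uniq s -> (forall i, measurable (F i)) ->
  (forall i j x, F i x -> F j x -> i = j) ->
  P (\big[setU/set0]_(i <- s) F i) = (\sum_(i <- s) P (F i))%E.
Proof.
move=> + mF disj; elim: s => [_|i s IH /= /andP[iNs us]].
  by rewrite !big_nil measure0.
have m2 : measurable (\big[setU/set0]_(j <- s) F j) by exact: bigsetU_measurable.
have dis : F i `&` \big[setU/set0]_(j <- s) F j = set0.
  rewrite -bigcup_seq; apply/seteqP; split=> // x [Fi [j /= js Fj]].
  by rewrite (disj _ _ _ Fi Fj) js in iNs.
by rewrite !big_cons; transitivity (P (F i) + P (\big[setU/set0]_(j <- s) F j))%E;
  [exact: measureU | rewrite IH].
Qed.

Lemma independent_seq d' (S : measurableType d') (I : choiceType) (D : set I)
    (X : I -> {RV P >-> S}) (s : seq I) (A : I -> set S) :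
  mutually_independent D X -> uniq s -> (forall i, i \in s -> D i) ->
  (forall i, measurable (A i)) ->
  P (\bigcap_(i in [set` s]) (X i @^-1` A i)) = (\prod_(i <- s) P (X i @^-1` A i))%E.
Proof.
move=> indep us sD mA; pose J := [fset i in s]%fset.
have JE : enum_fset J =i s by move=> i; rewrite -[LHS]/(i \in J) inE.
have setE : [set` J] = [set` s].
  by apply/seteqP; split => i /=; rewrite -[i \in J]/(i \in enum_fset J) JE.
rewrite -setE indep //; last by rewrite setE => i /=; exact: sD.
by apply: perm_big; apply: uniq_perm => //; exact: fset_uniq.
Qed.

End FiniteUnions.

Lemma prod_EFin (R : realType) (I : Type) (s : seq I) (f : I -> R) :
  (\prod_(i <- s) (f i)%:E = (\prod_(i <- s) f i)%:E)%E.
Proof.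
elim: s => [|i s IH]; first by rewrite !big_nil.
by rewrite !big_cons IH EFinM.
Qed.

Lemma poisson_pmfE (R : realType) (mu : R) z : 0 < mu -> poisson_pmf mu z =
  poisson_weight mu z.
Proof. by move=> mu0; rewrite /poisson_pmf mu0. Qed.

Section Laws.
Variables (R : realType) (d n r : nat).
Notation labelling := (labelling d n).

Lemma card_labelling : #|{: labelling}| = (n`! ^ d)%N.
Proof. by rewrite card_ffun card_ord card_Sn. Qed.

Section PermutationModel.
Variables (dO : measure_display) (Omega : measurableType dO) (P : probability Omega R).
Variable pi : 'I_d -> {RV P >-> 'S_n}.
Hypothesis model : permutation_model pi.

Let event (w : labelling) := \bigcap_(l in [set` enum 'I_d]) (pi l @^-1` [set w l]).

Let measurable_event w : measurable (event w).
Proof.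
apply: fin_bigcap_measurable => [|l _]; first exact: finite_seq.
by rewrite -[_ @^-1` _]setTI; apply: measurable_funPT.
Qed.

Let probability_event w : P (event w) = (#|{: labelling}|%:R^-1)%:E.
Proof.
have [indep unif] := model.
rewrite /event (independent_seq (A := fun l => [set w l]) indep) ?enum_uniq //.
rewrite (eq_bigr (fun=> (n`!%:R^-1)%:E)) => [|l _]; last exact: unif.
rewrite prod_EFin big_const_seq count_predT size_enum_ord iter_mulr_1 exprVn.
by rewrite card_labelling natrX.
Qed.

Let X omega := [tuple num_cycles (fun l => pi l omega) i.+1 | i < r].
Let Xw (w : labelling) := [tuple num_cycles w i.+1 | i < r].

Let XE omega (w : labelling) : (forall l, pi l omega = w l) -> X omega = Xw w.
Proof.
move=> E; apply: eq_from_tnth => i; rewrite !tnth_mktuple; congr (num_cycles _ _).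
by apply/funext => l; exact: E.
Qed.

Let preimageE (A : set (r.-tuple nat)) : X @^-1` A =
  \big[setU/set0]_(w <- [seq w <- enum {: labelling} | `[< A (Xw w) >]]) event w.
Proof.
rewrite -bigcup_seq; apply/seteqP; split => [omega Aw|omega [w /=]].
  exists [ffun l => pi l omega] => /=; last by move=> l _ /=; rewrite ffunE.
  by rewrite mem_filter mem_enum andbT; apply/asboolP; rewrite -(@XE omega) // => l;
    rewrite ffunE.
rewrite mem_filter => /andP[/asboolP Aw _] Ew; rewrite /preimage /= (@XE omega w) //
  => l.
by apply: Ew; rewrite /= mem_enum.
Qed.

Lemma measurable_cycle_counts A : measurable (X @^-1` A).
Proof. by rewrite preimageE; exact: bigsetU_measurable. Qed.

Lemma law_cycle_counts A : P (X @^-1` A) =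
  (#|[set w : labelling | `[< A (Xw w) >]]%SET|%:R / #|{: labelling}|%:R)%:E.
Proof.
rewrite preimageE probability_disjoint_union //; first 1 last.
- by apply: filter_uniq; exact: enum_uniq.
- move=> w w' omega Ew Ew'; apply/ffunP => l.
  have ll : [set` enum 'I_d] l by rewrite /= mem_enum.
  by rewrite -(Ew l ll) -(Ew' l ll).
- under eq_bigr do rewrite probability_event.
  rewrite sumEFin; congr (_%:E).
  rewrite big_const_seq count_predT iter_addr_0 -[LHS]mulr_natl; congr (_%:R * _).
  by rewrite size_filter -sum1_count big_enum_cond sum1dep_card; apply: eq_card => w;
    rewrite !inE.
Qed.

End PermutationModel.

Section PoissonModel.
Variables (dT : measure_display) (T : measurableType dT) (Q : probability T R).
Variable Z : nat -> {RV Q >-> nat}.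
Variable mu : 'I_r -> R.
Hypothesis mu_gt0 : forall i, 0 < mu i.
Hypothesis indep : mutually_independent [set k : nat | (1 <= k)%N] Z.
Hypothesis poisson : forall i : 'I_r, is_poisson (Z i.+1) (mu i).

Let Y t := [tuple Z i.+1 t | i < r].

Lemma measurable_poisson_tuple (A : set (r.-tuple nat)) : measurable A -> measurable
  (Y @^-1` A).
Proof.
move=> mA; rewrite -[_ @^-1` _]setTI; suff : measurable_fun setT Y by apply.
apply/measurable_fun_tnthP => i.
rewrite (_ : _ \o _ = Z i.+1); first exact: measurable_funPT.
by apply/funext => t /=; rewrite tnth_mktuple.
Qed.

Lemma law_poisson_ge K (A : set (r.-tuple nat)) : measurable A ->
  ((\sum_(z : {ffun 'I_r -> 'I_K} | `[< A [tuple val (z i) | i < r] >])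
     \prod_i poisson_weight (mu i) (z i))%:E <= Q (Y @^-1` A))%E.
Proof.
move=> mA.
pose s := [seq (i : 'I_r).+1 | i <- enum 'I_r].
(* [val_at] extends [z] to all indices so as to fit the shape of independence;
   the value 0 outside [s] is arbitrary *)
pose val_at (z : {ffun 'I_r -> 'I_K}) (k : nat) : nat :=
  if insub k.-1 is Some i then val (z i) else 0%N.
pose event z := \bigcap_(k in [set` s]) (Z k @^-1` [set val_at z k]).
have us : uniq s by rewrite map_inj_uniq ?enum_uniq // => i j [] /val_inj.
have val_atS z (i : 'I_r) : val_at z i.+1 = z i by rewrite /val_at /= valK.
have event_at z t (i : 'I_r) : event z t -> Z i.+1 t = z i.
  by move=> Ez; rewrite -val_atS; apply: Ez => /=; apply: map_f; rewrite mem_enum.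
have mevent z : measurable (event z).
  apply: fin_bigcap_measurable => [|k _]; first exact: finite_seq.
  by rewrite -[_ @^-1` _]setTI; apply: measurable_funPT.
have Pevent z : Q (event z) = (\prod_i poisson_weight (mu i) (z i))%:E.
  rewrite /event (independent_seq (A := fun k => [set val_at z k]) indep) //; last
    first.
    by move=> k /mapP[i _ ->].
  rewrite big_map -prod_EFin big_enum; apply: eq_bigr => i _.
  by rewrite val_atS; have := poisson i (z i); rewrite poisson_pmfE.
pose l := [seq z : {ffun 'I_r -> 'I_K} <- enum {: {ffun 'I_r -> 'I_K}} | `[< A [tuple
  val (z i) | i < r] >]].
have -> : (\sum_(z : {ffun 'I_r -> 'I_K} | `[< A [tuple val (z i) | i < r] >])
     \prod_i poisson_weight (mu i) (z i))%:E = Q (\big[setU/set0]_(z <- l) event z).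
  rewrite probability_disjoint_union //; first 1 last.
  - by apply: filter_uniq; exact: enum_uniq.
  - move=> z z' t Ez Ez'; apply/ffunP => i; apply: val_inj.
    by rewrite /= -(event_at z t i Ez) -(event_at z' t i Ez').
  - by under [in RHS]eq_bigr do rewrite Pevent; rewrite sumEFin big_filter
      big_enum_cond.
apply: le_measure; rewrite ?inE.
- exact: bigsetU_measurable.
- exact: measurable_poisson_tuple.
rewrite -bigcup_seq => t [z /=]; rewrite mem_filter => /andP[/asboolP Az _] Ez.
rewrite /preimage /= (_ : Y t = [tuple val (z i) | i < r]) //.
by apply: eq_from_tnth => i; rewrite !tnth_mktuple (event_at z t i Ez).
Qed.

End PoissonModel.
End Laws.

Section MainBound.
Variables (R : realType) (d n r : nat).
Hypothesis d2 : (2 <= d)%N.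
Hypothesis n0 : (0 < n)%N.
Hypothesis r0 : (0 < r)%N.

Local Notation error := (9000 * r%:R ^+ 2 * (2 * d - 1)%:R ^+ r * ln (2 * d - 1)%:R /
  n%:R : R).

Lemma one_le_error : (n < 4 * r)%N -> 1 <= error.
Proof.
move=> nr; have n0' : 0 < n%:R :> R by rewrite ltr0n.
have b3 := base_ge3 R d2; have lb := ln_base_ge R d2.
have r1 : 1 <= r%:R :> R by rewrite ler1n.
rewrite ler_pdivlMr // mul1r; set b := (2 * d - 1)%:R in b3 lb *; set l := ln b in lb *.
have br : 1 <= b ^+ r by rewrite exprn_ege1 //; lra.
have nr' : n%:R <= 4 * r%:R :> R by rewrite -natrM ler_nat ltnW.
apply: (le_trans nr').
have h : 1 <= b ^+ r * (2 * l).
  by rewrite -[leLHS]mul1r ler_pM //; lra.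
have h2 : r%:R <= r%:R ^+ 2 :> R by rewrite expr2 ler_peMr // ltW // ltr0n.
have h3 : r%:R ^+ 2 <= r%:R ^+ 2 * (b ^+ r * (2 * l)) :> R by rewrite ler_peMr ?sqr_ge0.
have -> : 9000 * r%:R ^+ 2 * b ^+ r * l = 4500 * (r%:R ^+ 2 * (b ^+ r * (2 * l))) by
  ring.
set X := r%:R ^+ 2 * (_ * _) in h3 *; lra.
Qed.

Variables (dO : measure_display) (Omega : measurableType dO)
  (P : probability Omega R) (pi : 'I_d -> {RV P >-> 'S_n}).
Hypothesis model : permutation_model pi.
Variables (dT : measure_display) (T : measurableType dT)
  (Q : probability T R) (Z : nat -> {RV Q >-> nat}).
Hypothesis indep : mutually_independent [set k : nat | (1 <= k)%N] Z.
Hypothesis poisson : forall k : nat, (1 <= k)%N ->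
  is_poisson (Z k) ((num_cyc_reduced d k)%:R / (2 * k)%:R).

Let X omega := [tuple num_cycles (fun l => pi l omega) i.+1 | i < r].
Let Y t := [tuple Z i.+1 t | i < r].

(** Only count vectors in the finite box of values taken by the cycle counts
    matter for the left-hand side, and restricting [A] to this box only
    decreases the Poisson probability. *)
Lemma one_sided_bound (A : set (r.-tuple nat)) : measurable A ->
  (P (X @^-1` A) <= Q (Y @^-1` A) + error%:E)%E.
Proof.
move=> mA; have mX : measurable (X @^-1` A) by exact: measurable_cycle_counts.
have mY : measurable (Y @^-1` A) by exact: measurable_poisson_tuple.
have [nr|nr] := ltnP n (4 * r).
  apply: (@le_trans _ _ 1%E); first exact: probability_le1.
  by apply: (@le_trans _ _ error%:E); rewrite ?lee_fin ?one_le_error // leeDr.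
have rate0 := @rate_gt0 R d d2 r.
pose K := (\max_(w : labelling d n) \max_(i < r) num_cycles w i.+1).+1.
pose A' := [pred z : {ffun 'I_r -> 'I_K} | `[< A [tuple val (z i) | i < r] >]].
have low := @law_poisson_ge R r dT T Q Z (@rate R d r) rate0 indep
  (fun i => poisson (ltn0Sn i)) K A mA.
rewrite (law_cycle_counts model); apply: le_trans (leeD2r _ low).
rewrite -EFinD lee_fin -lerBlDl.
have C_lt (w : labelling d n) i : (cycle_counts r w i < K)%N.
  rewrite ffunE ltnS; apply: leq_trans (leq_bigmax w).
  exact: (leq_bigmax (F := fun i : 'I_r => num_cycles w i.+1)).
have Omega0 : (0 < #|{: labelling d n}|)%N by apply/card_gt0P; exists [ffun=> 1%g].
have n0' : 0 < n%:R :> R by rewrite ltr0n.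
have S := stein_poisson_bound rate0 Omega0 C_lt
  (eps := fun k => rate R d k * (k.+1%:R ^+ 2 / n%:R))
  (eta := fun k j => rate R d k * k.+1%:R * (20 * ((2 * d - 1)%:R ^+ j.+1 / n%:R)))
  (fun k G b G2 Gl => cycle_counts_approx_identity d2 nr n0 Gl k G2) A'.
apply: (le_trans _ (@error_sum_bound R d d2 r n n0 r0)); apply: (le_trans _ S).
rewrite lerD2r ler_wpM2r ?invr_ge0 // ler_nat subset_leq_card //.
apply/fintype.subsetP => w; rewrite !inE => Aw; apply/existsP.
pose z : {ffun 'I_r -> 'I_K} := [ffun i => Ordinal (C_lt w i)].
have zE : [tuple val (z i) | i < r] = [tuple num_cycles w i.+1 | i < r].
  by apply: eq_from_tnth => i; rewrite !tnth_mktuple ffunE /= ffunE.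
exists z; apply/andP; split.
  by apply/asboolP; rewrite zE.
by apply/eqP/ffunP => i; rewrite !ffunE /= ffunE.
Qed.

(** The reverse inequality is the one-sided bound for the complement. *)
Lemma total_variation_bound :
  (tv_dist (pushforward P X) (pushforward Q Y) <= error%:E)%E.
Proof.
apply: ub_ereal_sup => _ [A mA <-]; rewrite /pushforward.
have mX B : measurable (X @^-1` B) by exact: measurable_cycle_counts.
have mY B : measurable B -> measurable (Y @^-1` B) by exact: measurable_poisson_tuple.
have := one_sided_bound mA; have := one_sided_bound (measurableC mA).
have -> : P (X @^-1` (~` A)) = (1 - P (X @^-1` A))%E by apply: (@probability_setC _ _
  _ P (X @^-1` A)).
have -> : Q (Y @^-1` (~` A)) = (1 - Q (Y @^-1` A))%E by apply: (@probability_setC _ _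
  _ Q (Y @^-1` A)); exact: mY.
have [pX qY] := (fin_num_measure P _ (mX A), fin_num_measure Q _ (mY A mA)).
rewrite -(fineK pX) -(fineK qY); move: (fine _) (fine _) error => p q e.
rewrite -EFinB abse_EFin -!EFinB -!EFinD !lee_fin ler_norml => h1 h2.
by apply/andP; split; lra.
Qed.

End MainBound.

Theorem theorem2p4 (R : realType) :
  exists c : R,
    forall d n r : nat, (2 <= d)%N -> (1 <= n)%N -> (1 <= r)%N ->
    forall (dO : measure_display) (Omega : measurableType dO)
      (P : probability Omega R) (pi : 'I_d -> {RV P >-> 'S_n}),
      permutation_model pi ->
    forall (dT : measure_display) (T : measurableType dT)
      (Q : probability T R) (Z : nat -> {RV Q >-> nat}),
      mutually_independent [set k : nat | (1 <= k)%N] Z ->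
      (forall k : nat, (1 <= k)%N ->
        is_poisson (Z k) ((num_cyc_reduced d k)%:R / (2 * k)%:R)) ->
    (tv_dist
       (pushforward P
          (fun omega => [tuple num_cycles (fun l => pi l omega) i.+1 | i < r]))
       (pushforward Q (fun t => [tuple Z i.+1 t | i < r]))
     <= (c * r%:R ^+ 2 * (2 * d - 1)%:R ^+ r * ln (2 * d - 1)%:R / n%:R)%:E)%E.
Proof.
exists 9000 => d n r d2 n0 r0 dO Omega P pi model dT T Q Z indep poisson.
exact: (total_variation_bound d2 n0 r0 model indep poisson).
Qed.
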